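(* Let $n\geqslant 1$ and $k\in(0,1)$. Assume that $(u_0,u_1)\in \mathcal{C}^2_0(\mathbb{R}^n)\times \mathcal{C}^1_0(\mathbb{R}^n)$ are nonnegative functions and have supports contained in $B_R=\{x\in\mathbb{R}^n:|x|<R\}$, where $R>0$. Consider an exponent $p$ in the nonlinearity of derivative type such that $$1<p\leqslant p_{\mathrm{Gla}}\big((1-k)n+2k+2\big).$$ Then there exists $\varepsilon_0=\varepsilon_0(n,p,k,u_0,u_1,R)>0$ such that for any $\varepsilon\in(0,\varepsilon_0]$ the following holds. If $u\in\mathcal{C}^2([1,T)\times\mathbb{R}^n)$ is a local in time solution to the Cauchy problem $$\begin{cases} \partial_t^2u-t^{-2k}\Delta u + 2t^{-1} \partial_t u=|\partial_t u|^p, & x\in \mathbb{R}^n, \ t>1,\\ u(1,x)=\varepsilon u_0(x), & x\in \mathbb{R}^n, \\ \partial_t u(1,x)=\varepsilon u_1(x), & x\in \mathbb{R}^n,\end{cases}$$ such that $\operatorname{supp} u(t,\cdot)\subset B_{R+A_k(t)}$ for any $t\in[1,T)$, and with lifespan $T=T(\varepsilon)$, then $u$ blows up in finite time, that is, $T<\infty$. Furthermore, the following upper bound estimate for the lifespan holds: $$T(\varepsilon)\leqslant \begin{cases} C\,\varepsilon^{-\left(\frac{1}{p-1}-\frac{(1-k)n+2k+1}{2}\right)^{-1}} & \text{if } 1<p<p_{\mathrm{Gla}}\big((1-k)n+2k+2\big),\\ \exp\big(C\varepsilon^{-(p-1)}\big) & \text{if } p=p_{\mathrm{Gla}}\big((1-k)n+2k+2\big),\end{cases}$$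 where the positive constant $C$ is independent of $\varepsilon$.
   Context: Notation. $n$ is the (integer) space dimension, and $B_r=\{x\in\mathbb{R}^n:|x|<r\}$. $\mathcal{C}^j_0(\mathbb{R}^n)$ denotes the $\mathcal{C}^j$ functions with compact support. The function $\phi_k(t)=\frac{t^{1-k}}{1-k}$ is the primitive of $t^{-k}$ vanishing at $t=0$, and $A_k(t)=\phi_k(t)-\phi_k(1)=\int_1^t\tau^{-k}\,\mathrm{d}\tau$. The Glassey exponent, evaluated at a real argument $m\geqslant 1$, is $p_{\mathrm{Gla}}(m)=\frac{m+1}{m-1}$ if $m>1$ and $p_{\mathrm{Gla}}(1)=\infty$. The constant $\varepsilon>0$ describes the size of the Cauchy data. The lifespan $T=T(\varepsilon)$ is the maximal existence time of the local in time solution $u$.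
   Formalization: The data (u_0,u_1) are additionally assumed not both identically zero; for u_0=u_1=0 the zero function is a global solution with T=∞, so the statement as written fails in that case. *)

(* Defs.v *)
From HB Require Import structures.
From mathcomp Require Import all_boot all_order all_algebra.
From mathcomp Require Import all_classical all_reals all_analysis.

Set Implicit Arguments.
Unset Strict Implicit.
Unset Printing Implicit Defensive.

Import Order.TTheory GRing.Theory Num.Theory.
Import numFieldNormedType.Exports.

Local Open Scope classical_set_scope.
Local Open Scope ring_scope.

Section Regularity.
Context {R : realType} {V : normedModType R}.
Implicit Types (D B : set V) (f : V -> R) (z v : V).

(* Directional derivatives relative to a domain D: only increments that stay
   in D are used, so that at a boundary point of D the derivative is one-sided.
   For D = setT they are [derivable] and ['D_v f z], see [derivable_inT] and
   [derive_inT]. *)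
Definition derivable_in D f z v :=
  cvg ((fun h : R => h^-1 *: (f (z + h *: v) - f z))
         @ within [set h | D (z + h *: v)] 0^').

Definition derive_in D f v z : R :=
  lim ((fun h : R => h^-1 *: (f (z + h *: v) - f z))
         @ within [set h | D (z + h *: v)] 0^').

(* [Cn B j D f]: f is of class C^j on D, that is, all partial derivatives of
   order at most j exist and are continuous on D; B is the set of coordinate
   directions. *)
Fixpoint Cn B (j : nat) D f : Prop :=
  {within D, continuous f} /\
  if j is i.+1 then
    forall v, B v ->
      (forall z, D z -> derivable_in D f z v) /\ Cn B i D (derive_in D f v)
  else True.

Definition supp f : set V := closure [set z | f z != 0].

Let quotient_inT f z v :
  (fun h : R => h^-1 *: (f (z + h *: v) - f z))
    @ within [set h | setT (z + h *: v)] 0^'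
  = (fun h : R => h^-1 *: ((f \o shift z) (h *: v) - f z)) @ 0^'.
Proof.
have -> : within [set h : R | setT (z + h *: v)] 0^' = 0^'.
  apply/seteqP; split => P /=; rewrite /within /=.
    by apply: filterS => h; exact.
  by apply: filterS => h Ph _.
suff -> : (fun h : R => h^-1 *: (f (z + h *: v) - f z))
  = (fun h : R => h^-1 *: ((f \o shift z) (h *: v) - f z)) by [].
by apply/funext => h /=; rewrite [z + _]addrC.
Qed.

Lemma derivable_inT f z v : derivable_in setT f z v = derivable f z v.
Proof. by rewrite /derivable_in quotient_inT. Qed.

Lemma derive_inT f v z : derive_in setT f v z = 'D_v f z.
Proof. by rewrite /derive_in quotient_inT. Qed.

End Regularity.

Section Problem.
Context {R : realType} {n : nat}.
Implicit Types (k p eps t : R) (x : 'rV[R]_n) (T : \bar R).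
Implicit Types (u w : R * 'rV[R]_n -> R).

(* The library norm on row vectors is the sup norm. *)
Definition enorm x : R := Num.sqrt (\sum_(i < n) x 0 i ^+ 2).

Definition eball (r : R) : set 'rV[R]_n := [set x | enorm x < r].

Definition space_dir : set 'rV[R]_n := range (fun i : 'I_n => delta_mx 0 i).

Definition C0j (j : nat) (f : 'rV[R]_n -> R) : Prop :=
  Cn space_dir j setT f /\ compact (supp f).

Definition dir_t : R * 'rV[R]_n := (1, 0).
Definition dir_x (i : 'I_n) : R * 'rV[R]_n := (0, delta_mx 0 i).
Definition spacetime_dir : set (R * 'rV[R]_n) := [set dir_t] `|` range dir_x.

Definition slab T : set (R * 'rV[R]_n) :=
  [set z | 1 <= z.1 /\ (z.1%:E < T)%E].

Definition Dt T u := derive_in (slab T) u dir_t.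
Definition Dx T (i : 'I_n) u := derive_in (slab T) u (dir_x i).
Definition Laplacian T u z : R := \sum_(i < n) Dx T i (Dx T i u) z.

Definition phi_k k t : R := t `^ (1 - k) / (1 - k).
Definition A_k k t : R := phi_k k t - phi_k k 1.

Definition solution k p eps (u0 u1 : 'rV[R]_n -> R) T u : Prop :=
  [/\ Cn spacetime_dir 2 (slab T) u,
      forall t x, 1 < t -> (t%:E < T)%E ->
        Dt T (Dt T u) (t, x) - t `^ (- (2 * k)) * Laplacian T u (t, x)
          + 2 * t^-1 * Dt T u (t, x) = `|Dt T u (t, x)| `^ p,
      forall x, u (1, x) = eps * u0 x &
      forall x, Dt T u (1, x) = eps * u1 x].

Definition supp_cone k (r : R) T u : Prop :=
  forall t, 1 <= t -> (t%:E < T)%E ->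
    supp (fun x => u (t, x)) `<=` eball (r + A_k k t).

(* T is the lifespan of u: no solution on a longer interval extends u. *)
Definition is_lifespan k p eps (u0 u1 : 'rV[R]_n -> R) u T : Prop :=
  forall (T' : \bar R) w, (T < T')%E -> solution k p eps u0 u1 T' w ->
    ~ (forall z, slab T z -> w z = u z).

End Problem.

Definition pGla {R : realType} (m : R) : \bar R :=
  if 1 < m then ((m + 1) / (m - 1))%:E else +oo%E.

(* Main.v *)
Require Import Defs.
From HB Require Import structures.
From mathcomp Require Import all_boot all_order all_algebra.
From mathcomp Require Import all_classical all_reals all_analysis.
From mathcomp Require Import ring lra.

Set Implicit Arguments.
Unset Strict Implicit.
Unset Printing Implicit Defensive.

Import Order.TTheory GRing.Theory Num.Theory.
Import numFieldNormedType.Exports.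

Local Open Scope classical_set_scope.
Local Open Scope ring_scope.

(** The proof averages the equation over space against a positive solution of
    Delta w = w and studies the resulting ordinary differential inequality.

    Average. With w(x) = exp(x_1) and U(t) the integral of u(t,x) w(x), two
    integrations by parts give
      U'' + (2/t) U' - t^(-2k) U = F,   F(t) = integral of |u_t|^p w >= 0.
    The integral is taken to be the limit of Riemann sums along an ultrafilter
    (mean): this limit is linear, monotone and annihilates partial derivatives
    (mean_derive0), and sums of products of functions of one coordinate factorize.

    Linear analysis. V = t U satisfies V'' = t^(-2k) V + t F. Nonnegative data
    give V'(1) >= V(1) >= 0, and then V' >= t^(-k) V for all times. It follows that
    P = V' + t^(-k) V satisfies P' >= (t^(-k) - k/(2t)) P + t F, that is,
      Z = t^(k/2) exp(-A(t)) P   has   Z' >= t^(k/2 + 1) exp(-A(t)) F,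
    where A(t) is the primitive of t^(-k) vanishing at 1 (dprofile_ge). For t >= 2
    one also has U' >= c t^(-1) P (le_profile_velocity).

    Nonlinear feedback. Since u_t is supported in the ball of radius
    rho = r + A(t), Jensen's inequality gives F >= U' (U' / B)^(p-1) where U' > 0; here
    B is the integral of w over that ball. Comparison with a product of exponentials of
    the single coordinates shows B <= K exp(rho) rho^((n-1)/2) (wmean_ball_le), and
    rho is at most a constant times t^(1-k). All exponentials cancel, and
      Z' >= c t^(-(p-1) gam) Z^p,   gam = ((1-k) n + 2k + 1)/2,
    with Z bounded below by a multiple of eps (solution_riccati).

    Lifespan. Integrating this Riccati inequality bounds the integral of
    t^(-(p-1) gam) from 2 to any time of existence by a multiple of eps^(1-p). The
    condition on p says that (p-1) gam <= 1, so that the integral diverges, as a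
    power of t when the inequality is strict and as a logarithm otherwise
    (power_time, exponential_time). *)

(** * Sums over equally spaced nodes of a line *)
Section Nodes.
Context {R : realType}.
Implicit Types (a b e s : R) (G h : R -> R) (N : nat).

Definition res N := (2 * N.+1 ^ 2)%N.

(** The step 1/(N+1) and the half-length N+1 are tied together, so that the single
    limit of large N both refines the nodes and exhausts the line. *)
Definition node N (j : nat) : R := j%:R / N.+1%:R - N.+1%:R.

Let N1_gt0 N : 0 < N.+1%:R :> R. Proof. by rewrite ltr0n. Qed.

Lemma node0 N : node N 0 = - N.+1%:R.
Proof. by rewrite /node mul0r sub0r. Qed.

Lemma nodeS N j : node N j.+1 = node N j + N.+1%:R^-1.
Proof. by rewrite /node -[j.+1]addn1 natrD mulrDl mul1r addrAC. Qed.

Lemma node_last N : node N (res N) = N.+1%:R.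
Proof.
rewrite /node /res natrM natrX; have := N1_gt0 N.
by move: (N.+1%:R : R) => x x0; field; rewrite gt_eqF.
Qed.

(** A discrete integral test: the increments of a function G over one step
    telescope, so it suffices to dominate h by difference quotients of G. Taking
    -h and -G turns this upper bound into a lower bound. *)
Lemma sum_nodes_le N G h :
  (forall s, h s / N.+1%:R <= G (s + N.+1%:R^-1) - G s) ->
  (\sum_(j < (res N).+1) h (node N j)) / N.+1%:R
    <= G (N.+1%:R + N.+1%:R^-1) - G (- N.+1%:R).
Proof.
move=> hG; rewrite mulr_suml.
apply: (@le_trans _ _ (\sum_(j < (res N).+1) (G (node N j.+1) - G (node N j)))).
  by apply: ler_sum => j _; rewrite nodeS.
rewrite -(big_mkord xpredT (fun j => G (node N j.+1) - G (node N j))).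
by rewrite telescope_sumr// nodeS node_last node0.
Qed.

(** The two tails of the exponential are compared separately, each with the
    increments of its own primitive. The primitive of the left tail is frozen only
    one unit beyond a, so that a step crossing a still counts in full; that of the
    right tail is multiplied by expR b^-1, because its increments are governed by
    the end of the step, where the exponential is smaller. *)
Lemma sum_nodes_exp N a b : 0 < b ->
  (\sum_(j < (res N).+1) expR (- `|node N j - a| / b)) / N.+1%:R
    <= 2 * b * expR b^-1.
Proof.
move=> b0; set d := (N.+1%:R : R)^-1.
have d0 : 0 < d by rewrite invr_gt0.
have d1 : d <= 1 by rewrite invf_le1// ler1n.
pose X s := (s - a) / b.
pose G1 s := Num.min (expR (X s)) (expR b^-1).
pose G2 s := - (expR b^-1 * Num.min (expR (- X s)) 1).
have Xd s : X (s + d) = X s + d / b by rewrite /X -mulrDl addrAC.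
have db0 : 0 < d / b by rewrite divr_gt0.
have dbV : d / b <= b^-1 by rewrite ler_piMl// ltW// invr_gt0.
have G1_ge0 s : 0 <= G1 (s + d) - G1 s.
  rewrite subr_ge0 /G1 Xd le_min !ge_min lexx !orbT andbT /=.
  by rewrite ler_expR lerDl ltW.
have G2_ge0 s : 0 <= G2 (s + d) - G2 s.
  rewrite /G2 opprK addrC subr_ge0 ler_wpM2l ?expR_ge0// Xd.
  rewrite le_min !ge_min lexx !orbT andbT /=.
  by rewrite ler_expR lerN2 lerDl ltW.
have e1 (y : R) : 1 + y <= expR y by exact: expR_ge1Dx.
pose G s := b * (G1 s + G2 s).
have hG s : expR (- `|s - a| / b) * d <= G (s + d) - G s.
  rewrite /G -mulrBr.
  have -> : G1 (s + d) + G2 (s + d) - (G1 s + G2 s)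
    = (G1 (s + d) - G1 s) + (G2 (s + d) - G2 s) by ring.
  have [sa|sa] := leP s a.
    apply: (@le_trans _ _ (b * (G1 (s + d) - G1 s))); last first.
      by rewrite ler_pM2l// lerDl.
    have X0 : X s <= 0 by rewrite /X pmulr_lle0 ?invr_gt0// subr_le0.
    have -> : - `|s - a| / b = X s by rewrite ler0_norm ?subr_le0// opprK.
    rewrite /G1 Xd (min_idPl _); last first.
      by rewrite ler_expR -[leRHS]add0r lerD.
    rewrite (min_idPl _); last first.
      by rewrite ler_expR (le_trans X0)// ltW// invr_gt0.
    rewrite expRD -{3}[expR (X s)]mulr1 -mulrBr [b * _]mulrCA ler_pM2l ?expR_gt0//.
    have := e1 (d / b); rewrite addrC -lerBrDr => h.
    by rewrite -(ler_pM2l b0) [b * (d / b)]mulrCA mulfV ?gt_eqF// mulr1 in h.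
  apply: (@le_trans _ _ (b * (G2 (s + d) - G2 s))); last first.
    by rewrite ler_pM2l// lerDr.
  have X0 : 0 < X s by rewrite divr_gt0// subr_gt0.
  have -> : - `|s - a| / b = - X s by rewrite gtr0_norm ?subr_gt0// mulNr.
  rewrite /G2 Xd (min_idPl _); last first.
    by rewrite -[leRHS]expR0 ler_expR oppr_le0 addr_ge0// ltW.
  rewrite (min_idPl _); last first.
    by rewrite -[leRHS]expR0 ler_expR oppr_le0 ltW.
  rewrite opprK addrC -mulrBr opprD expRD -{2}[expR (- X s)]mulr1 -mulrBr.
  rewrite [expR b^-1 * _]mulrCA [b * _]mulrCA ler_pM2l ?expR_gt0//.
  have : d / b <= expR b^-1 * (1 - expR (- (d / b))).
    apply: (@le_trans _ _ (expR (d / b) * (1 - expR (- (d / b))))).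
      rewrite mulrBr mulr1 -expRD subrr expR0 lerBrDr addrC; exact: e1.
    rewrite ler_wpM2r ?ler_expR// subr_ge0 -[leRHS]expR0 ler_expR oppr_le0.
    exact: ltW.
  by move=> h; rewrite -(ler_pM2l b0) [b * (d / b)]mulrCA mulfV ?gt_eqF// mulr1 in h.
apply: le_trans (sum_nodes_le hG) _.
rewrite /G -mulrBr mulrAC [leRHS]mulrC ler_pM2l//.
have := expR_ge0 b^-1; set E := expR _ => E0.
have G1l s : 0 <= G1 s <= E by rewrite /G1 le_min !expR_ge0 ge_min lexx orbT.
have G2l s : - E <= G2 s <= 0.
  rewrite /G2 lerN2 oppr_le0 mulr_ge0 ?le_min ?expR_ge0 ?ler01// andbT.
  by rewrite -[leRHS]mulr1 ler_wpM2l// ge_min lexx orbT.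
move: (G1l (N.+1%:R + d)) (G2l (N.+1%:R + d)) (G1l (- N.+1%:R)) (G2l (- N.+1%:R)).
lra.
Qed.

(** Comparison with the identity clamped to the interval of radius e/2 around a:
    it grows by e in total, and only over steps that start in the interval of
    radius e once the step is at most e/2. *)
Lemma sum_nodes_indic N a e : 0 < e -> N.+1%:R^-1 <= e / 2 :> R ->
  `|a| + e <= N.+1%:R ->
  e <= (\sum_(j < (res N).+1) (`|node N j - a| <= e)%R%:R) / N.+1%:R.
Proof.
move=> e0 Ne aN; set d := (N.+1%:R : R)^-1.
have d0 : 0 < d by rewrite invr_gt0.
pose G s := - Num.max (a - e / 2) (Num.min s (a + e / 2)).
have hG s : - (`|s - a| <= e)%R%:R * d <= G (s + d) - G s.
  rewrite /G mulNr lerNl opprD !opprK ler_distl.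
  have dd : d <= e / 2 := Ne.
  have [h1|h1] := leP (a - e) s; have [h2|h2] := leP s (a + e);
  have [h3|h3] := leP s (a + e / 2); have [h4|h4] := leP (s + d) (a + e / 2);
  rewrite /= ?mul1r ?mul0r;
  do 2?[case: (leP (a - e / 2) _) => ?]; lra.
have := sum_nodes_le hG.
have -> : \sum_(j < (res N).+1) - (`|node N j - a| <= e)%R%:R
  = - (\sum_(j < (res N).+1) (`|node N j - a| <= e)%R%:R) :> R.
  by rewrite -sumrN.
rewrite mulNr lerNl; apply: le_trans.
rewrite /G opprD !opprK.
have := aN; have := ler_norm a; have := ler_norm (- a); rewrite normrN => a1 a2 a3.
rewrite [Num.min (_ + d) _](min_idPr _); last by lra.
rewrite [Num.max _ (a + _)](max_idPr _); last by lra.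
rewrite [Num.min _ _](min_idPl _); last by lra.
rewrite [Num.max _ _](max_idPl _); last by lra.
lra.
Qed.

End Nodes.

(** * A translation invariant mean on functions of bounded support *)
Section RiemannMean.
Context {R : realType} {n : nat}.
Implicit Types (f g : 'rV[R]_n -> R) (x : 'rV[R]_n) (i : 'I_n) (M rho : R).

Lemma ler_coord_norm x i : `|x 0 i| <= `|x|.
Proof.
rewrite [leRHS]/Num.norm /= mx_normrE; apply/bigmax_geP; right => /=.
by exists (0, i).
Qed.

Lemma ltr_norm_coord x rho : 0 <= rho -> rho < `|x| -> exists i, rho < `|x 0 i|.
Proof.
move=> rho0; rewrite [ltRHS]/Num.norm /= mx_normrE => /bigmax_gtP[|[[j i] _ /=]].
  by rewrite ltNge rho0.
by rewrite ord1 => ?; exists i.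
Qed.

Lemma norm_delta_le i (h : R) : `|h *: (delta_mx 0 i : 'rV[R]_n)| <= `|h|.
Proof.
rewrite normrZ ler_piMr// leNgt; apply/negP => /(ltr_norm_coord ler01)[j].
rewrite mxE eqxx/=; case: (j == i); rewrite ?normr1 ?normr0 ?ltxx//.
by rewrite ltNge ler01.
Qed.

Lemma norm_step_gt x i (h rho : R) : `|h| <= 1 -> rho + 1 < `|x| ->
  rho < `|x + h *: delta_mx 0 i|.
Proof.
move=> h1 xrho; have := ler_normB (x + h *: delta_mx 0 i) (h *: delta_mx 0 i).
rewrite addrK; have := norm_delta_le i h; move: xrho h1.
by move: `|x| `|h| `|h *: _| `|_ + _| => a b c d; lra.
Qed.

Definition grid_pt N (g : {ffun 'I_n -> 'I_(res N).+1}) : 'rV[R]_n :=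
  \row_i node N (g i).

Definition riemann_sum f N : R :=
  (\sum_(g : {ffun 'I_n -> 'I_(res N).+1}) f (grid_pt g)) / N.+1%:R ^+ n.

Lemma le_riemann_sum f g N :
  (forall x, f x <= g x) -> riemann_sum f N <= riemann_sum g N.
Proof.
move=> fg; rewrite ler_wpM2r ?invr_ge0 ?exprn_ge0//.
by apply: ler_sum => h _; exact: fg.
Qed.

Lemma riemann_sum_linear f g (c : R) N :
  riemann_sum (fun x => c * f x + g x) N
  = c * riemann_sum f N + riemann_sum g N.
Proof. by rewrite /riemann_sum big_split/= -mulr_sumr mulrDl mulrA. Qed.

(** This factorization is what reduces every estimate of a sum over the
    n-dimensional grid to sums over nodes of the line. *)
Lemma riemann_sum_prod (h : 'I_n -> R -> R) N :
  riemann_sum (fun x => \prod_i h i (x 0 i)) N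
  = \prod_i ((\sum_(j < (res N).+1) h i (node N j)) / N.+1%:R).
Proof.
rewrite /riemann_sum big_split/= [in RHS]big_const_ord iter_mulr_1 exprVn.
congr (_ / _); rewrite bigA_distr_bigA/=.
by apply: eq_bigr => g _; apply: eq_bigr => i _; rewrite mxE.
Qed.

(** A cyclic permutation of the nodes in direction i realizes the translation by
    one step. Where the cycle wraps around, both the translated point and the
    grid point that replaces it lie outside the support of f. *)
Lemma riemann_sum_shift f i rho N :
  (forall x, rho < `|x| -> f x = 0) -> rho < N.+1%:R ->
  riemann_sum (fun x => f (x + N.+1%:R^-1 *: delta_mx 0 i)) N
  = riemann_sum f N.
Proof.
move=> f0 rhoN; rewrite /riemann_sum; congr (_ / _).
pose sh (g : {ffun 'I_n -> 'I_(res N).+1}) : {ffun 'I_n -> 'I_(res N).+1} :=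
  [ffun j => if j == i then ordS (g j) else g j].
have sh_inj : injective sh.
  move=> g1 g2 /ffunP g12; apply/ffunP => j; have := g12 j; rewrite !ffunE.
  by case: ifP => // _; exact: ordS_inj.
rewrite [RHS](reindex_inj sh_inj)/=; apply: eq_bigr => g _.
have [gi|gi] := eqVneq (g i : nat) (res N).
  rewrite !f0 //.
  - apply: (lt_le_trans rhoN); apply: le_trans (ler_coord_norm _ i).
    rewrite mxE ffunE eqxx /= gi modnn node0 normrN.
    by rewrite ger0_norm.
  - apply: (lt_le_trans rhoN); apply: le_trans (ler_coord_norm _ i).
    by rewrite !mxE !eqxx /= gi node_last mulr1 ger0_norm ?lerDl ?invr_ge0.
congr f; apply/rowP => j; rewrite !mxE ffunE eqxx/=.
case: eqVneq => [->|]; last by rewrite mulr0 addr0.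
rewrite mulr1 -nodeS; congr node; rewrite /= modn_small//.
by rewrite ltnS ltn_neqAle gi -ltnS ltn_ord.
Qed.

(** The class contains the indicator functions of balls, whose mean enters the
    Jensen inequality. *)
Definition bounded_support f :=
  exists M rho, forall x, `|f x| <= M /\ (rho < `|x| -> f x = 0).

Lemma bounded_supportP f : bounded_support f ->
  exists M rho, [/\ 0 <= M, 0 <= rho, forall x, `|f x| <= M &
    forall x, rho < `|x| -> f x = 0].
Proof.
case=> M [rho fM]; exists M, (Num.max rho 0); split.
- by case: (fM 0) => + _; exact: le_trans.
- by rewrite le_max lexx orbT.
- by move=> x; case: (fM x).
- by move=> x; rewrite gt_max => /andP[/(fM x).2].
Qed.

Lemma bounded_supportD f g (c : R) : bounded_support f -> bounded_support g ->
  bounded_support (fun x => c * f x + g x).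
Proof.
move=> /bounded_supportP[M1 [r1 [M10 r10 fM fr]]].
move=> /bounded_supportP[M2 [r2 [M20 r20 gM gr]]].
exists (`|c| * M1 + M2), (Num.max r1 r2) => x; split.
  by rewrite (le_trans (ler_normD _ _))// lerD// normrM ler_wpM2l.
by rewrite gt_max => /andP[/fr -> /gr ->]; rewrite mulr0 add0r.
Qed.

Lemma riemann_sum_le f M (a b : 'I_n -> R) N : (forall i, 0 < b i) ->
  (forall x, f x <= M * \prod_i expR (- `|x 0 i - a i| / b i)) -> 0 <= M ->
  riemann_sum f N <= M * \prod_i (2 * b i * expR (b i)^-1).
Proof.
move=> b0 fM M0; apply: le_trans (le_riemann_sum _ fM) _.
have -> : (fun x : 'rV[R]_n => M * \prod_i expR (- `|x 0 i - a i| / b i))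
  = (fun x : 'rV[R]_n => M * \prod_i expR (- `|x 0 i - a i| / b i)
      + (cst 0 : 'rV[R]_n -> R) x).
  by apply/funext => x; rewrite addr0.
rewrite riemann_sum_linear {2}/riemann_sum big1// mul0r addr0 ler_wpM2l//.
rewrite (riemann_sum_prod (fun i s => expR (- `|s - a i| / b i))).
apply: ler_prod => i _; apply/andP; split; last exact: sum_nodes_exp.
by rewrite divr_ge0// sumr_ge0// => j _; exact: expR_ge0.
Qed.

Lemma indic_le_prod_exp x rho : 0 <= rho -> `|x| <= rho ->
  1 <= expR rho ^+ n * \prod_i expR (- `|x 0 i - 0| / 1).
Proof.
move=> rho0 xrho; rewrite -[X in expR rho ^+ X]card_ord -prodr_const -big_split/=.
rewrite [leLHS](_ : 1 = \prod_(i in 'I_n) (1 : R)); last by rewrite big1.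
apply: ler_prod => i _; rewrite ler01/= -expRD subr0 divr1 -expR0 ler_expR subr_ge0.
exact: le_trans (ler_coord_norm _ _) xrho.
Qed.

(** Bound for the Riemann sums of the indicator of a box of half-side rho, obtained
    by dominating the indicator of [-rho, rho] by expR (rho - |s|). *)
Definition box_mass rho : R := expR rho ^+ n * \prod_(i < n) (2 * 1 * expR (1 : R)^-1).

Lemma box_mass_gt0 rho : 0 < box_mass rho.
Proof.
apply: mulr_gt0; first by rewrite exprn_gt0 ?expR_gt0.
by apply: prodr_gt0 => i _; rewrite !mulr_gt0 ?expR_gt0.
Qed.

Lemma riemann_sum_norm_le f M rho N : 0 <= rho ->
  (forall x, `|f x| <= M) -> (forall x, rho < `|x| -> f x = 0) ->
  `|riemann_sum f N| <= M * box_mass rho.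
Proof.
move=> rho0 fM f0; have M0 : 0 <= M := le_trans (normr_ge0 _) (fM 0).
have bound g : (forall x, `|g x| <= M) -> (forall x, rho < `|x| -> g x = 0) ->
    riemann_sum g N <= M * box_mass rho.
  move=> gM g0; rewrite mulrA.
  apply: (@riemann_sum_le _ _ (fun=> 0) (fun=> 1)) => // [x|]; last first.
    by rewrite mulr_ge0// exprn_ge0// expR_ge0.
  have [xrho|/g0 ->] := leP `|x| rho; last first.
    by rewrite !mulr_ge0 ?exprn_ge0 ?expR_ge0// prodr_ge0// => i _; exact: expR_ge0.
  rewrite (le_trans (ler_norm _))// (le_trans (gM x))//.
  by rewrite -mulrA ler_peMr// indic_le_prod_exp.
rewrite ler_norml bound// andbT lerNl.
have -> : - riemann_sum f N = riemann_sum (fun x => - f x) N.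
  by rewrite /riemann_sum sumrN mulNr.
by apply: bound => [x|x /f0 ->]; rewrite ?normrN ?oppr0.
Qed.

(** Limits along an ultrafilter exist for all bounded sequences and are linear, so
    the mean below is linear on all functions of bounded support, whether or not
    their Riemann sums converge. *)
Definition free_ultrafilter : set_system nat :=
  projT1 (cid (ultraFilterLemma eventually_filter)).

#[local] Instance free_ultrafilter_ultra : UltraFilter free_ultrafilter.
Proof. by rewrite /free_ultrafilter; case: cid => ? []. Qed.

Lemma free_ultrafilter_eventually (P : set nat) :
  (\forall N \near \oo, P N) -> free_ultrafilter P.
Proof.
by rewrite /free_ultrafilter; case: cid => U /= [_ sub] /sub.
Qed.

Lemma ultra_fmap (S T : Type) (F : set_system S) (f : S -> T) :
  UltraFilter F -> UltraFilter (f x @[x --> F]).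
Proof.
move=> FU; split => [|G GF FG]; first exact: fmap_proper_filter.
apply/seteqP; split => // A GA.
have [//|FA] := in_ultra_setVsetC (f @^-1` A) FU.
have GCA : G (~` A) by exact: FG.
have : G (A `&` ~` A) by exact: filterI.
by rewrite setICr => /filter_not_empty.
Qed.

Definition mean f : R := lim (riemann_sum f @ free_ultrafilter).

Lemma mean_cvg f : bounded_support f ->
  riemann_sum f @ free_ultrafilter --> mean f.
Proof.
move=> /bounded_supportP[M [rho [M0 rho0 fM f0]]].
set B := M * box_mass rho.
have bnd N : `|riemann_sum f N| <= B by exact: riemann_sum_norm_le.
have /= := @segment_compact R (- B) B; rewrite compact_ultra.
move=> /(_ (riemann_sum f @ free_ultrafilter) (ultra_fmap _ _)) [].
  by apply: nearW => N; rewrite /= in_itv/= -ler_norml.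
by move=> l [_ fl]; apply/cvg_ex; exists l.
Unshelve. all: by end_near. Qed.

Lemma meanE f l : riemann_sum f @ free_ultrafilter --> l -> mean f = l.
Proof. exact: cvg_lim. Qed.

Lemma meanD f g (c : R) : bounded_support f -> bounded_support g ->
  mean (fun x => c * f x + g x) = c * mean f + mean g.
Proof.
move=> bf bg; apply: meanE.
have -> : riemann_sum (fun x => c * f x + g x)
  = (fun N => c * riemann_sum f N + riemann_sum g N).
  by apply/funext => N; rewrite riemann_sum_linear.
by apply: cvgD; [apply: cvgMr; exact: mean_cvg|exact: mean_cvg].
Qed.

Lemma mean0 : mean (fun=> 0) = 0.
Proof.
apply: meanE; rewrite (_ : riemann_sum _ = fun=> 0); first exact: cvg_cst.
by apply/funext => N; rewrite /riemann_sum big1// mul0r.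
Qed.

Lemma bounded_support0 : bounded_support (fun=> 0).
Proof. by exists 0, 0 => x; rewrite normr0. Qed.

Lemma meanZ f (c : R) : bounded_support f -> mean (fun x => c * f x) = c * mean f.
Proof.
move=> bf; rewrite -[RHS]addr0 -mean0 -meanD//; last exact: bounded_support0.
by congr mean; apply/funext => x; rewrite addr0.
Qed.

Lemma mean_le_prod f M (a b : 'I_n -> R) : bounded_support f ->
  (forall i, 0 < b i) -> 0 <= M ->
  (forall x, f x <= M * \prod_i expR (- `|x 0 i - a i| / b i)) ->
  mean f <= M * \prod_i (2 * b i * expR (b i)^-1).
Proof.
move=> bf b0 M0 fM; apply: (cvgr_to_le (mean_cvg bf)).
by near=> N; exact: (@riemann_sum_le _ _ a).
Unshelve. all: by end_near. Qed.

Lemma le_mean f g : bounded_support f -> bounded_support g ->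
  (forall x, f x <= g x) -> mean f <= mean g.
Proof.
move=> bf bg fg; apply: (ler_cvg_to (mean_cvg bf) (mean_cvg bg)).
by near=> N; exact: le_riemann_sum.
Unshelve. all: by end_near. Qed.

Lemma mean_bounded rho : exists2 C : R, 0 < C & forall f M,
  (forall x, `|f x| <= M) -> (forall x, rho < `|x| -> f x = 0) ->
  `|mean f| <= C * M.
Proof.
pose r := Num.max rho 0.
exists (box_mass r) => [|f M fM f0]; first exact: box_mass_gt0.
have bf : bounded_support f by exists M, rho => x; split => //; exact: f0.
rewrite mulrC; apply: cvgr_to_le (cvg_norm (mean_cvg bf)) _.
apply: nearW => N; apply: riemann_sum_norm_le => //.
  by rewrite le_max lexx orbT.
by move=> x; rewrite gt_max => /andP[/f0].
Qed.

Lemma near_free_inv (e : R) : 0 < e ->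
  \forall N \near free_ultrafilter, N.+1%:R^-1 < e.
Proof.
move=> e0; apply: free_ultrafilter_eventually.
exact: (near_infty_natSinv_lt (PosNum e0)).
Qed.

Lemma near_free_gt (e : R) : \forall N \near free_ultrafilter, e < N.+1%:R.
Proof.
apply: free_ultrafilter_eventually; near=> N.
have : e < N%:R by near: N; exact: nbhs_infty_gtr.
by move=> /lt_trans; apply; rewrite ltr_nat.
Unshelve. all: by end_near. Qed.

(** The Riemann sums of the indicator of a box of half-side e are at least e ^+ n
    when N is large, so the limit cannot vanish. *)
Lemma mean_gt0 f x0 (c e : R) : bounded_support f -> (forall x, 0 <= f x) ->
  0 < c -> 0 < e -> (forall x, `|x - x0| <= e -> c <= f x) -> 0 < mean f.
Proof.
move=> bf f0 c0 e0 fc.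
apply: (@lt_le_trans _ _ (c * e ^+ n)); first by rewrite mulr_gt0// exprn_gt0.
apply: (cvgr_to_ge (mean_cvg bf)); near=> N.
apply: (@le_trans _ _ (riemann_sum (fun x =>
    c * (\prod_i (`|x 0 i - x0 0 i| <= e)%R%:R) + (cst 0 : 'rV[R]_n -> R) x) N)).
  rewrite riemann_sum_linear (riemann_sum_prod (fun i s => (`|s - x0 0 i| <= e)%R%:R)).
  rewrite [X in _ + X](_ : _ = 0) ?addr0 ?ler_pM2l//; last first.
    by rewrite /riemann_sum big1// mul0r.
  rewrite -[X in e ^+ X]card_ord -prodr_const; apply: ler_prod => i _.
  rewrite ltW//=; apply: sum_nodes_indic => //.
    by apply: ltW; near: N; apply: near_free_inv; rewrite divr_gt0.
  apply: (@le_trans _ _ (`|x0| + e)); first by rewrite lerD2r ler_coord_norm.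
  by apply: ltW; near: N; exact: near_free_gt.
apply: le_riemann_sum => x; rewrite addr0.
have [xe|xe] := pselect (forall i, `|x 0 i - x0 0 i| <= e).
  rewrite big1 ?mulr1; last by move=> i _; rewrite xe.
  apply: fc; rewrite leNgt; apply/negP => /(ltr_norm_coord (ltW e0))[i].
  by rewrite !mxE ltNge xe.
have /existsNP[i /negP/negbTE xi] : ~ (forall i, `|x 0 i - x0 0 i| <= e) by [].
by rewrite (bigD1 i)//= xi mul0r mulr0.
Unshelve. all: by end_near. Qed.

(** The integral of a derivative vanishes. The Riemann sum of the difference
    quotient of f over exactly one grid step is zero by translation invariance,
    and this quotient is uniformly close to g with a fixed bounded support. *)
Lemma mean_derive0 f g i : bounded_support f -> bounded_support g ->
  (forall e : R, 0 < e -> \forall h \near (0 : R),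
     forall x, `|f (x + h *: delta_mx 0 i) - f x - h * g x| <= e * `|h|) ->
  mean g = 0.
Proof.
move=> bf bg fg.
have [Mf [rf [_ rf0 _ f0]]] := bounded_supportP bf.
have [Mg [rg [_ _ _ g0]]] := bounded_supportP bg.
pose r0 := Num.max rf rg; pose r := r0 + 1.
suff bound e : 0 < e -> `|mean g| <= e * box_mass r.
  apply/eqP; rewrite -normr_le0; apply/ler_addgt0Pr => e e0; rewrite add0r.
  have B0 := box_mass_gt0 r.
  apply: le_trans (bound (e / box_mass r) _) _; first by rewrite divr_gt0.
  by rewrite divfK// gt_eqF.
move=> e0; apply: cvgr_to_le (cvg_norm (mean_cvg bg)) _.
have fg' : \forall N \near free_ultrafilter, forall x,
    `|f (x + N.+1%:R^-1 *: delta_mx 0 i) - f x - N.+1%:R^-1 * g x| <= e * N.+1%:R^-1.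
  have /nbhs_ballP[d d0 dP] := fg e e0.
  have := near_free_inv d0; apply: filterS => N Nd x.
  have := dP N.+1%:R^-1; rewrite /ball/= sub0r normrN ger0_norm ?invr_ge0//.
  by move=> /(_ Nd x).
near=> N.
set d := (N.+1%:R : R)^-1.
have d0 : 0 < d by rewrite invr_gt0.
pose q x := d^-1 * (f (x + d *: delta_mx 0 i) - f x) - g x.
have qe x : `|q x| <= e.
  have := near fg' N; move=> /(_ _ x); rewrite -/d => H.
  rewrite -(ler_pM2l d0) -{1}(gtr0_norm d0) -normrM /q mulrBr mulrA mulfV ?gt_eqF// mul1r.
  by rewrite [d * e]mulrC; exact: H.
have q0 x : r < `|x| -> q x = 0.
  move=> xr; have : r0 < `|x + d *: delta_mx 0 i|.
    by apply: norm_step_gt => //; rewrite gtr0_norm// invf_le1// ler1n.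
  have : r0 < `|x| by apply: lt_trans xr; rewrite ltrDl.
  rewrite !gt_max => /andP[/f0 fx /g0 gx] /andP[/f0 fdx _].
  by rewrite /q fdx fx gx subrr mulr0 subrr.
(* the difference quotient has sum zero, so g and -q have the same sum *)
have -> : riemann_sum g N = - riemann_sum q N.
  have -> : riemann_sum q N = d^-1 *
      (riemann_sum (fun x => f (x + d *: delta_mx 0 i)) N - riemann_sum f N)
      - riemann_sum g N.
    rewrite /riemann_sum -[in RHS]mulrBl -sumrB [in RHS]mulrA -[in RHS]mulrBl.
    by rewrite mulr_sumr -sumrB.
  rewrite (@riemann_sum_shift f i rf)//; last by near: N; exact: near_free_gt.
  by rewrite subrr mulr0 sub0r opprK.
rewrite normrN; apply: riemann_sum_norm_le => //.
by rewrite addr_ge0// le_max rf0.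
Unshelve. all: by end_near. Qed.

End RiemannMean.

(** * Calculus on the line *)
Section Calculus.
Context {R : realType}.
Implicit Types (f g df : R -> R) (a b c d k t x y : R).

Lemma is_derive_continuous f x d : is_derive x 1 f d -> {for x, continuous f}.
Proof. by move=> [fx _]; exact/differentiable_continuous/derivable1_diffP. Qed.

Lemma is_derive_mul f g x a b : is_derive x 1 f a -> is_derive x 1 g b ->
  is_derive x 1 (fun t => f t * g t) (a * g x + f x * b).
Proof.
move=> fa gb; have := is_deriveM fa gb; rewrite /= => h.
apply: is_derive_eq h _; rewrite addrC; congr (_ + _); exact: mulrC.
Qed.

Lemma is_derive_add f g x a b : is_derive x 1 f a -> is_derive x 1 g b ->
  is_derive x 1 (fun t => f t + g t) (a + b).
Proof. by move=> fa gb; exact: is_deriveD. Qed.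

Lemma is_derive_sub f g x a b : is_derive x 1 f a -> is_derive x 1 g b ->
  is_derive x 1 (fun t => f t - g t) (a - b).
Proof. by move=> fa gb; exact: is_deriveB. Qed.

Lemma is_derive_ident x : is_derive x 1 (fun t : R => t) 1.
Proof. exact: is_derive_id. Qed.

Lemma is_derive_const c x : is_derive x 1 (fun _ : R => c) 0.
Proof. exact: is_derive_cst. Qed.

Lemma is_derive_exp f x a : is_derive x 1 f a ->
  is_derive x 1 (fun t => expR (f t)) (expR (f x) * a).
Proof.
move=> fa; exact: (@is_derive1_comp R expR f x _ _ (is_derive_expR _) fa).
Qed.

Lemma is_derive_powR f x a b : 0 < f x -> is_derive x 1 f a ->
  is_derive x 1 (fun t => f t `^ b) (b * f x `^ (b - 1) * a).
Proof.
move=> f0 fa; exact: (@is_derive1_comp R (fun s => s `^ b) f x _ _ (is_derive1_powR b f0) fa).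
Qed.

Lemma ge0_is_derive_le f df a b : a <= b ->
  (forall t, a <= t <= b -> {for t, continuous f}) ->
  (forall t, a < t < b -> is_derive t 1 f (df t)) ->
  (forall t, a < t < b -> 0 <= df t) -> f a <= f b.
Proof.
move=> ab fc fd d0; have [t||c _ e] := @MVT_segment R f (fun t => if a < t < b then df t else 0) a b ab.
- by rewrite in_itv/= => /[dup] tab ->; exact: fd.
- apply: continuous_in_subspaceT => t; rewrite inE/= in_itv/=; exact: fc.
rewrite -subr_ge0 e mulr_ge0 ?subr_ge0//.
by case: ifP => // /d0.
Qed.

(** Continuity induction: the supremum of the times up to which f is positive
    cannot be smaller than b. *)
Lemma continuous_pos_persists f a b : a <= b ->
  (forall t, a <= t <= b -> {for t, continuous f}) -> 0 < f a ->
  (forall s, a < s <= b -> (forall t, a <= t < s -> 0 < f t) -> 0 < f s) ->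
  forall t, a <= t <= b -> 0 < f t.
Proof.
move=> ab fc fa step.
pose E := [set s | a <= s <= b /\ forall t, a <= t <= s -> 0 < f t].
have Ea : E a.
  split; first by rewrite lexx.
  by move=> t /andP[at_ ta]; have -> : t = a by apply/eqP; rewrite eq_le ta.
have hE : has_sup E by split; [exists a|exists b => s [/andP[]]].
pose c := sup E.
have ac : a <= c by exact: sup_upper_bound.
have cb : c <= b by apply: sup_le_ub; [exists a|move=> s [/andP[]]].
have ltc t : a <= t < c -> 0 < f t.
  move=> /andP[at_ tc]; have [s [sab Es] ts] := sup_gt (ex_intro _ a Ea) tc.
  by apply: Es; rewrite at_ ltW.
have fc0 : 0 < f c.
  move: ac; rewrite le_eqVlt => /predU1P[<-//|ac].
  by apply: step => //; rewrite ac.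
have [bc|cb'] := leP b c.
  move=> t /andP[at_ tb]; move: (le_trans tb bc); rewrite le_eqVlt => /predU1P[->//|tc].
  by apply: ltc; rewrite at_.
have /fc cc : a <= c <= b by rewrite ac cb.
have /nbhs_ballP[d d0 dP] : \forall t \near c, 0 < f t by exact: (cvgr_gt _ cc).
pose s := Num.min b (c + d / 2).
have cs : c < s by rewrite lt_min cb' ltrDl divr_gt0.
have : E s.
  split; first by rewrite ge_min lexx (le_trans ac (ltW cs)).
  move=> t /andP[at_ ts]; have [ct|tc] := leP c t; last by apply: ltc; rewrite at_.
  apply: dP; rewrite /ball/= distrC ger0_norm ?subr_ge0// ltrBlDl.
  apply: (le_lt_trans ts); rewrite gt_min; apply/orP; right.
  by rewrite ltrD2l ltr_pdivrMr// ltr_pMr// ltr1n.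
by move=> /(sup_upper_bound hE); rewrite leNgt cs.
Qed.

Lemma gt0_powRD t a b : 0 < t -> t `^ (a + b) = t `^ a * t `^ b.
Proof. by move=> t0; rewrite powRD// (gt_eqF t0) implybT. Qed.

Lemma gt0_powRB1 t a : 0 < t -> t `^ (a - 1) = t `^ a / t.
Proof. by move=> t0; rewrite gt0_powRD// powR_inv1// ltW. Qed.

Lemma is_derive_A_k k t : k < 1 -> 0 < t -> is_derive t 1 (A_k k) (t `^ (- k)).
Proof.
move=> k1 t0; have := is_derive1_powR (1 - k) t0 => h.
have h' := is_derive_sub (is_derive_mul h (is_derive_const (1 - k)^-1 t)) (is_derive_const (phi_k k 1) t).
apply: is_derive_eq h' _.
rewrite mulr0 addr0 subr0 mulrAC mulfV ?mul1r ?gt_eqF ?subr_gt0//.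
by rewrite addrAC subrr add0r.
Qed.

Lemma A_k1 k : A_k k 1 = 0. Proof. exact: subrr. Qed.

Lemma le_A_k k s t : 0 < k < 1 -> 1 <= s <= t -> A_k k s <= A_k k t.
Proof.
move=> /andP[k0 k1] /andP[s1 st]; rewrite lerD2r ler_pdivrMr ?subr_gt0//.
rewrite divfK ?gt_eqF ?subr_gt0//; apply: ge0_ler_powR => //.
- by rewrite subr_ge0 ltW.
- by rewrite nnegrE (le_trans ler01).
- by rewrite nnegrE (le_trans _ st)// (le_trans ler01).
Qed.

End Calculus.

(** * The ordinary differential equation of the average *)
Section WaveODE.
Context {R : realType}.
Implicit Types (s t : R).
Variables (k : R) (T : \bar R) (U U1 F : R -> R).
Hypothesis k01 : 0 < k < 1.
Hypothesis contU : forall t, 1 <= t -> (t%:E < T)%E -> {for t, continuous U}.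
Hypothesis contU1 : forall t, 1 <= t -> (t%:E < T)%E -> {for t, continuous U1}.
Hypothesis derU : forall t, 1 < t -> (t%:E < T)%E -> is_derive t 1 U (U1 t).
Hypothesis derU1 : forall t, 1 < t -> (t%:E < T)%E ->
  is_derive t 1 U1 (F t + t `^ (- (2 * k)) * U t - 2 * t^-1 * U1 t).
Hypothesis F_ge0 : forall t, 1 < t -> (t%:E < T)%E -> 0 <= F t.
Hypothesis U_ge0 : 0 <= U 1.
Hypothesis U1_ge0 : 0 <= U1 1.
Hypothesis UU1_gt0 : 0 < U 1 + U1 1.

Let V t := t * U t.
Let V1 t := U t + t * U1 t.
Let a t := t `^ (- k).
Let P t := V1 t + a t * V t.

(** V = t U satisfies V'' = t^(-2k) V + t F, which has no first order term. For
    F = 0 the growing solution behaves like V ~ t^(k/2) exp(A(t)), so that V' and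
    t^(-k) V both behave like t^(-k/2) exp(A(t)). The profile is P = V' + t^(-k) V
    divided by this behaviour: it is nearly constant without source, and the
    source makes it grow. *)
Definition profile t := t `^ (k / 2) * expR (- A_k k t) * P t.

Let k0 : 0 < k. Proof. by case/andP: k01. Qed.
Let k1 : k < 1. Proof. by case/andP: k01. Qed.
Let lt_T (s t : R) : s <= t -> (t%:E < T)%E -> (s%:E < T)%E.
Proof. by move=> st; apply: le_lt_trans; rewrite lee_fin. Qed.
Let pos1 (t : R) : 1 <= t -> 0 < t. Proof. exact: lt_le_trans. Qed.

Let a_gt0 t : 0 < t -> 0 < a t. Proof. exact: powR_gt0. Qed.
Let a_sqr t : 0 < t -> t `^ (- (2 * k)) = a t * a t.
Proof.
move=> t0; rewrite -gt0_powRD//.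
by congr (_ `^ _); ring.
Qed.
Let der_a t : 0 < t -> is_derive t 1 a (- (k / t) * a t).
Proof.
move=> t0; apply: is_derive_eq (is_derive1_powR (- k) t0) _.
rewrite gt0_powRB1// /a; ring.
Qed.

Let derV t : 1 < t -> (t%:E < T)%E -> is_derive t 1 V (V1 t).
Proof.
move=> t1 tT; apply: is_derive_eq (is_derive_mul (is_derive_ident t) (derU t1 tT)) _.
by rewrite mul1r.
Qed.

Let derV1 t : 1 < t -> (t%:E < T)%E ->
  is_derive t 1 V1 (a t * a t * V t + t * F t).
Proof.
move=> t1 tT; have t0 : 0 < t by exact: lt_trans t1.
apply: is_derive_eq (is_derive_add (derU t1 tT)
  (is_derive_mul (is_derive_ident t) (derU1 t1 tT))) _.
rewrite -a_sqr// /V; field; exact: lt0r_neq0.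
Qed.

Let contM (f g : R -> R) t : {for t, continuous f} -> {for t, continuous g} ->
  {for t, continuous (fun s => f s * g s)}.
Proof. exact: continuousM. Qed.
Let contD (f g : R -> R) t : {for t, continuous f} -> {for t, continuous g} ->
  {for t, continuous (fun s => f s + g s)}.
Proof. exact: continuousD. Qed.
Let contid t : {for t, continuous (fun s : R => s)}.
Proof. exact: cvg_id. Qed.

Let contV t : 1 <= t -> (t%:E < T)%E -> {for t, continuous V}.
Proof. by move=> t1 tT; apply: contM; [exact: contid|exact: contU]. Qed.
Let contV1 t : 1 <= t -> (t%:E < T)%E -> {for t, continuous V1}.
Proof.
move=> t1 tT; apply: contD; first exact: contU.
by apply: contM; [exact: contid|exact: contU1].
Qed.
Let conta t : 1 <= t -> {for t, continuous a}.
Proof. by move=> /pos1 /der_a; exact: is_derive_continuous. Qed.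
Let contP t : 1 <= t -> (t%:E < T)%E -> {for t, continuous P}.
Proof.
move=> t1 tT; apply: contD; first exact: contV1.
by apply: contM; [exact: conta|exact: contV].
Qed.

Let V_at1 : V 1 = U 1. Proof. by rewrite /V mul1r. Qed.
Let V1_at1 : V1 1 = U 1 + U1 1. Proof. by rewrite /V1 mul1r. Qed.
Let a_at1 : a 1 = 1. Proof. by rewrite /a powR1. Qed.

(** As long as V is increasing it is nonnegative, hence convex by its equation,
    hence V stays increasing. The initial slope of V is U 1 + U1 1 > 0. *)
Let V_ge0_of t : 1 <= t -> (t%:E < T)%E -> (forall s, 1 <= s < t -> 0 < V1 s) ->
  0 <= V t.
Proof.
move=> t1 tT V1pos; apply: (@le_trans _ _ (V 1)); first by rewrite V_at1.
apply: (@ge0_is_derive_le _ V V1) => // s.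
- by move=> /andP[s1 st]; apply: contV => //; exact: lt_T st tT.
- by move=> /andP[s1 st]; apply: derV => //; exact: lt_T (ltW st) tT.
- by move=> /andP[s1 st]; apply/ltW/V1pos; rewrite ltW.
Qed.

Let V1_gt0 t : 1 <= t -> (t%:E < T)%E -> 0 < V1 t.
Proof.
move=> t1 tT; apply: (@continuous_pos_persists _ V1 1 t) => //.
- by move=> s /andP[s1 st]; apply: contV1 => //; exact: lt_T st tT.
- by rewrite V1_at1.
- move=> s /andP[s1 st] pos; apply: (@lt_le_trans _ _ (V1 1)); first by rewrite V1_at1.
  have sT := lt_T st tT.
  apply: (@ge0_is_derive_le _ V1 (fun r => a r * a r * V r + r * F r)); first exact: ltW.
  + by move=> r /andP[r1 rs]; apply: contV1 => //; exact: lt_T rs sT.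
  + by move=> r /andP[r1 rs]; apply: derV1 => //; exact: lt_T (ltW rs) sT.
  + move=> r /andP[r1 rs]; have rT := lt_T (ltW rs) sT.
    have r0 : 0 < r by exact: lt_trans r1.
    have a0 := ltW (a_gt0 r0).
    apply: addr_ge0; last by rewrite mulr_ge0 ?F_ge0// ltW.
    apply: mulr_ge0; first exact: mulr_ge0.
    apply: V_ge0_of => //; first exact: ltW.
    by move=> q /andP[q1 qr]; apply: pos; rewrite q1 (lt_trans qr).
- by rewrite t1 lexx.
Qed.

Let V_ge0 t : 1 <= t -> (t%:E < T)%E -> 0 <= V t.
Proof.
move=> t1 tT; apply: V_ge0_of => // s /andP[s1 st].
by apply: V1_gt0 => //; exact: lt_T (ltW st) tT.
Qed.

Let derA t : 0 < t -> is_derive t 1 (A_k k) (a t).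
Proof. exact: is_derive_A_k. Qed.

Let derE t : 0 < t -> is_derive t 1 (fun s => expR (A_k k s)) (expR (A_k k t) * a t).
Proof. by move=> t0; exact/is_derive_exp/derA. Qed.

(** The quantity Q = V' - t^(-k) V solves Q' = - t^(-k) Q + (k/t) t^(-k) V + t F and
    Q 1 = U1 1 >= 0, so the integrating factor exp(A(t)) shows that it stays
    nonnegative. *)
Let Q_ge0 t : 1 <= t -> (t%:E < T)%E -> a t * V t <= V1 t.
Proof.
move=> t1 tT; rewrite -subr_ge0.
pose Q s := V1 s - a s * V s.
suff : 0 <= expR (A_k k t) * Q t by rewrite pmulr_rge0 ?expR_gt0.
apply: (@le_trans _ _ (expR (A_k k 1) * Q 1)).
  by rewrite mulr_ge0 ?expR_ge0// /Q V1_at1 a_at1 V_at1 mul1r addrAC subrr add0r.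
apply: (@ge0_is_derive_le _ (fun s => expR (A_k k s) * Q s)
    (fun s => expR (A_k k s) * (s * F s + k / s * a s * V s))) => // s /andP[s1 st].
- have sT := lt_T st tT.
  apply: contM; first exact: is_derive_continuous (derE (pos1 s1)).
  apply: continuousB; first exact: contV1.
  by apply: contM; [exact: conta|exact: contV].
- have sT := lt_T (ltW st) tT; have s0 : 0 < s by exact: lt_trans s1.
  apply: is_derive_eq (is_derive_mul (derE s0) (is_derive_sub (derV1 s1 sT)
    (is_derive_mul (der_a s0) (derV s1 sT)))) _.
  rewrite /Q; ring.
- have sT := lt_T (ltW st) tT; have s0 : 0 < s by exact: lt_trans s1.
  apply: mulr_ge0; first exact: expR_ge0.
  apply: addr_ge0; first by rewrite mulr_ge0 ?F_ge0// ltW.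
  apply: mulr_ge0; last by apply: V_ge0 => //; exact: ltW.
  by rewrite mulr_ge0 ?divr_ge0 ?(ltW k0) ?(ltW s0) ?(ltW (a_gt0 s0)).
Qed.

Let derh t : 0 < t -> is_derive t 1 (fun s => s `^ (k / 2) * expR (- A_k k s))
  ((k / 2 / t - a t) * (t `^ (k / 2) * expR (- A_k k t))).
Proof.
move=> t0.
have dN : is_derive t 1 (fun s => - A_k k s) (- a t).
  by have := is_derive_sub (is_derive_const 0 t) (derA t0);
    under [X in is_derive _ _ X _]eq_fun do rewrite sub0r; rewrite sub0r.
apply: is_derive_eq (is_derive_mul (is_derive1_powR (k / 2) t0) (is_derive_exp dN)) _.
rewrite gt0_powRB1//; ring.
Qed.

Lemma profile_continuous t : 1 <= t -> (t%:E < T)%E -> {for t, continuous profile}.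
Proof.
move=> t1 tT; apply: contM; last exact: contP.
exact: is_derive_continuous (derh (pos1 t1)).
Qed.

Let h t := t `^ (k / 2) * expR (- A_k k t).
Definition dprofile t := h t * (t * F t + k / 2 / t * (V1 t - a t * V t)).

(** In P' = t^(-k) P + t F - (k/t) t^(-k) V one replaces t^(-k) V by (P - Q)/2: the
    part in P is cancelled by the normalization of the profile, and besides the
    source there remains k/(2t) times Q, which is nonnegative. *)
Lemma is_derive_profile t : 1 < t -> (t%:E < T)%E ->
  is_derive t 1 profile (dprofile t).
Proof.
move=> t1 tT; have t0 : 0 < t by exact: lt_trans t1.
apply: is_derive_eq (is_derive_mul (derh t0) (is_derive_add (derV1 t1 tT)
    (is_derive_mul (der_a t0) (derV t1 tT)))) _.
rewrite /dprofile /P /h; field; exact: lt0r_neq0.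
Qed.

Lemma dprofile_ge t : 1 < t -> (t%:E < T)%E ->
  t `^ (k / 2) * expR (- A_k k t) * (t * F t) <= dprofile t.
Proof.
move=> t1 tT; have t0 : 0 < t by exact: lt_trans t1.
rewrite /dprofile /h ler_wpM2l ?mulr_ge0 ?powR_ge0 ?expR_ge0// lerDl.
by rewrite mulr_ge0 ?divr_ge0 ?(ltW k0) ?(ltW t0)// subr_ge0 Q_ge0// ltW.
Qed.

Lemma profile_ge t : 1 <= t -> (t%:E < T)%E -> U 1 + U1 1 <= profile t.
Proof.
move=> t1 tT; apply: (@le_trans _ _ (profile 1)).
  by rewrite /profile powR1 A_k1 oppr0 expR0 !mul1r /P V1_at1 a_at1 V_at1 mul1r lerDl.
apply: (@ge0_is_derive_le _ profile dprofile) => // s /andP[s1 st].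
- by apply: profile_continuous => //; exact: lt_T st tT.
- by apply: is_derive_profile => //; exact: lt_T (ltW st) tT.
- have sT := lt_T (ltW st) tT; apply: le_trans (dprofile_ge s1 sT).
  by rewrite !mulr_ge0 ?powR_ge0 ?expR_ge0 ?F_ge0 // ltW// (lt_trans _ s1).
Qed.

(** Writing U = t^(k-1) (t^(-k) V) gives t U' = V' - U >= (1 - t^(k-1)) V', because
    t^(-k) V <= V'. The factor degenerates at t = 1, which is why times t >= 2 are
    considered, and V' is at least half of P. *)
Lemma le_profile_velocity t : 2 <= t -> (t%:E < T)%E ->
  (1 - 2 `^ (k - 1)) / 2 * (t `^ (- (1 + k / 2)) * expR (A_k k t) * profile t) <= U1 t.
Proof.
move=> t2 tT; have t1 : 1 <= t by apply: le_trans t2; rewrite ler1n.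
have t0 := pos1 t1.
have -> : t `^ (- (1 + k / 2)) * expR (A_k k t) * profile t = t^-1 * P t.
  rewrite /profile expRN opprD gt0_powRD//.
  rewrite !powRN powRr1 ?ltW//.
  have := powR_gt0 (k / 2) t0; have := expR_gt0 (A_k k t).
  move: (expR _) (t `^ _) => x y x0 y0; field.
  by rewrite !lt0r_neq0.
have tk : t `^ (k - 1) <= 2 `^ (k - 1).
  rewrite -opprB !powRN lef_pV2 ?posrE ?powR_gt0// ge0_ler_powR ?nnegrE ?(ltW t0)//.
  by rewrite subr_ge0 ltW.
have key : U t = t `^ (k - 1) * (a t * V t).
  rewrite mulrA -gt0_powRD//.
  rewrite addrAC subrr add0r powR_inv1 ?ltW// /V mulrA mulVf ?mul1r ?gt_eqF//.
have U1E : t * U1 t = V1 t - U t by rewrite /V1 addrAC subrr add0r.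
rewrite -(ler_pM2l t0) U1E key.
have -> : t * ((1 - 2 `^ (k - 1)) / 2 * (t^-1 * P t)) = (1 - 2 `^ (k - 1)) / 2 * P t.
  by field; rewrite lt0r_neq0.
have Q0 := Q_ge0 t1 tT.
have y0 : 0 <= a t * V t by rewrite mulr_ge0 ?V_ge0// ltW// a_gt0.
have c0 : 0 <= 1 - 2 `^ (k - 1) :> R.
  rewrite subr_ge0 -[leRHS](powRr0 2) ler_powR ?ler1n// subr_le0; exact: ltW.
rewrite /P; have := powR_ge0 t (k - 1).
move: (t `^ _) (2 `^ _) (a t * V t) (V1 t) tk Q0 y0 c0 => x c y v *; nra.
Qed.

End WaveODE.

(** * From a Riccati inequality to the lifespan *)
Section Riccati.
Context {R : realType}.
Implicit Types (t p c z B K eps : R).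

(** The function Z^(1-p) + c (p-1) Phi is nonincreasing and its first term is
    positive. *)
Lemma riccati_time (T : \bar R) (Z dZ Phi : R -> R) p c theta z :
  1 < p -> 0 < c -> 0 < z ->
  (forall t, 2 <= t -> (t%:E < T)%E -> {for t, continuous Z}) ->
  (forall t, 2 < t -> (t%:E < T)%E -> is_derive t 1 Z (dZ t)) ->
  (forall t, 2 < t -> (t%:E < T)%E -> c * t `^ (- theta) * Z t `^ p <= dZ t) ->
  (forall t, 2 <= t -> (t%:E < T)%E -> z <= Z t) ->
  (forall t, 0 < t -> is_derive t 1 Phi (t `^ (- theta))) ->
  forall t, 2 <= t -> (t%:E < T)%E -> c * (p - 1) * (Phi t - Phi 2) <= z `^ (1 - p).
Proof.
move=> p1 c0 z0 cZ dZ' Zineq Zz dPhi t t2 tT.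
have sT s : s <= t -> (s%:E < T)%E by move=> st; apply: le_lt_trans tT; rewrite lee_fin.
have p0 : 0 < p - 1 by rewrite subr_gt0.
pose G s := - 1 * (Z s `^ (1 - p)) - c * (p - 1) * Phi s.
pose dG s := (p - 1) * (Z s `^ (- p) * dZ s - c * s `^ (- theta)).
have Zpos s : 2 <= s <= t -> 0 < Z s.
  by move=> /andP[s2 st]; apply: lt_le_trans z0 _; apply: Zz => //; exact: sT.
have : G 2 <= G t.
  apply: (@ge0_is_derive_le _ G dG) => // s /andP[s2 st].
  - have s0 : 0 < s by apply: lt_le_trans s2.
    apply: continuousB; last first.
      by apply: continuousM; [exact: cst_continuous|exact: is_derive_continuous (dPhi s s0)].
    apply: continuousM; first exact: cst_continuous.
    apply: (@continuous_comp _ _ _ Z (fun y => y `^ (1 - p))).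
      by apply: cZ => //; exact: sT.
    apply: is_derive_continuous; apply: is_derive1_powR.
    by apply: Zpos; rewrite s2.
  - have s0 : 0 < s by apply: lt_trans s2.
    have Zs0 : 0 < Z s by apply: Zpos; rewrite !ltW.
    apply: is_derive_eq (is_derive_sub (is_derive_mul (is_derive_const (- 1) s)
       (is_derive_powR (1 - p) Zs0 (dZ' s s2 (sT s (ltW st)))))
       (is_derive_mul (is_derive_const (c * (p - 1)) s) (dPhi s s0))) _.
    rewrite /dG; have -> : 1 - p - 1 = - p by ring.
    ring.
  - have Zs0 : 0 < Z s by apply: Zpos; rewrite !ltW.
    rewrite mulr_ge0 ?(ltW p0)// subr_ge0.
    apply: le_trans (ler_wpM2l (powR_ge0 _ _) (Zineq s s2 (sT s (ltW st)))).
    by rewrite mulrCA -gt0_powRD// addNr powRr0 mulr1.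
rewrite /G.
have Z2 : Z 2 `^ (1 - p) <= z `^ (1 - p).
  rewrite -opprB !powRN lef_pV2 ?posrE ?powR_gt0// ?Zpos ?lexx//.
  apply: ge0_ler_powR; rewrite ?nnegrE ?(ltW p0) ?(ltW z0)//.
    by rewrite (ltW (Zpos _ _))// lexx.
  by apply: Zz => //; exact: sT.
have := powR_ge0 (Z t) (1 - p).
move: (Z t `^ _) (Z 2 `^ _) (z `^ _) Z2 (Phi t) (Phi 2) (c * (p - 1)) => x y w yw u v a x0.
by rewrite mulrBr; lra.
Qed.

(** Only powers of t survive on the left: the exponentials of A cancel, because
    the velocity and the mass of the ball grow with the same exponential. *)
Lemma source_ge_profile (k p K kap beta A t Z U1 F : R) :
  1 < p -> 0 < K -> 0 < kap -> 0 < t -> 0 < Z ->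
  kap * (t `^ (- (1 + k / 2)) * expR A * Z) <= U1 ->
  U1 * (U1 / (K * (expR A * t `^ beta))) `^ (p - 1) <= F ->
  kap * (kap / K) `^ (p - 1) * t `^ (- ((p - 1) * (1 + k / 2 + beta))) * Z `^ p
    <= t `^ (k / 2) * expR (- A) * (t * F).
Proof.
move=> p1 K0 kap0 t0 Z0 U1ge Fge.
have tk0 : 0 < t `^ (k / 2) by exact: powR_gt0.
have E0 : 0 < expR A by exact: expR_gt0.
have tb0 : 0 < t `^ beta by exact: powR_gt0.
have p0 : 0 < p - 1 by rewrite subr_gt0.
pose X := t `^ (- (1 + k / 2)) * expR A.
have X0 : 0 < X by rewrite mulr_gt0// powR_gt0.
have XV : t `^ (k / 2) * expR (- A) * t = X^-1.
  rewrite /X expRN powRN gt0_powRD// powRr1 ?ltW// invfM invrK; ring.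
have y0 : 0 < kap * (X * Z) by apply: mulr_gt0 => //; exact: mulr_gt0.
rewrite mulrA XV ler_pdivlMl//; apply: le_trans Fge.
have q0 : 0 <= (U1 / (K * (expR A * t `^ beta))) `^ (p - 1) by exact: powR_ge0.
apply: le_trans (ler_wpM2r q0 U1ge).
have -> : X * (kap * (kap / K) `^ (p - 1) * t `^ (- ((p - 1) * (1 + k / 2 + beta))) * Z `^ p)
  = (kap * (X * Z)) * ((kap / K) * Z * t `^ (- (1 + k / 2 + beta))) `^ (p - 1).
  have kK0 : 0 <= kap / K by rewrite divr_ge0 ?ltW.
  rewrite [X in _ = _ * X]powRM ?powR_ge0//; last exact: mulr_ge0 kK0 (ltW Z0).
  rewrite [in RHS]powRM ?(ltW Z0)//.
  rewrite -powRrM mulNr [(1 + _ + _) * _]mulrC.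
  rewrite -(mulr_powRB1 (ltW Z0) (lt_trans ltr01 p1)); ring.
rewrite ler_wpM2l ?(ltW y0)//; apply: ge0_ler_powR; first exact: ltW.
- by rewrite nnegrE !mulr_ge0 ?invr_ge0 ?powR_ge0// ltW.
- rewrite nnegrE divr_ge0//; first exact: le_trans (ltW y0) U1ge.
  by rewrite !mulr_ge0 ?powR_ge0 ?expR_ge0// ltW.
apply: (@le_trans _ _ (kap * (X * Z) / (K * (expR A * t `^ beta)))); last first.
  by rewrite ler_wpM2r// invr_ge0 !mulr_ge0 ?powR_ge0 ?expR_ge0// ltW.
rewrite /X [in leLHS]opprD gt0_powRD// [in leLHS]powRN le_eqVlt; apply/orP; left; apply/eqP.
rewrite !powRN; move: (powR_gt0 (1 + k / 2) t0) => s0.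
move: (t `^ (1 + k / 2)) s0 (t `^ beta) tb0 (expR A) E0 => s s0 b b0 E E0.
by field; rewrite ?lt0r_neq0//.
Qed.

Lemma is_derive_phi_k theta t : theta < 1 -> 0 < t ->
  is_derive t 1 (phi_k theta) (t `^ (- theta)).
Proof.
move=> th1 t0.
have h := is_derive_add (is_derive_A_k th1 t0) (is_derive_const (phi_k theta 1) t).
rewrite addr0 in h; apply: near_eq_is_derive h => //.
by near=> s; rewrite /A_k subrK.
Unshelve. all: by end_near. Qed.

Lemma ge1_powRB eps p : 0 < eps <= 1 -> 1 <= p -> 1 <= eps `^ (1 - p).
Proof.
move=> e01 p1; rewrite -[leLHS](powRr0 eps); apply: ger_powR => //.
by rewrite subr_le0.
Qed.

(** The choice of C also makes the bound at least 2 for eps <= 1, which settles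
    the times t < 2. *)
Lemma power_time p gam c z : 1 < p -> (p - 1) * gam < 1 -> 0 < c -> 0 < z ->
  exists2 C : R, 0 < C & forall eps t, 0 < eps <= 1 -> 0 < t ->
    (2 <= t -> c * (p - 1) * (phi_k ((p - 1) * gam) t - phi_k ((p - 1) * gam) 2)
                <= (z * eps) `^ (1 - p)) ->
    t <= C * eps `^ (- ((p - 1)^-1 - gam)^-1).
Proof.
move=> p1 th1 c0 z0; set th := (p - 1) * gam.
have p0 : 0 < p - 1 by rewrite subr_gt0.
have d0 : 0 < 1 - th by rewrite subr_gt0.
pose M := z `^ (1 - p) / (c * (p - 1)).
have M0 : 0 < M by rewrite divr_gt0 ?powR_gt0// mulr_gt0.
pose D := 2 `^ (1 - th) + (1 - th) * M.
have D0 : 0 < D by apply: addr_gt0; [exact: powR_gt0|exact: mulr_gt0].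
exists (D `^ (1 - th)^-1) => [|eps t /andP[e0 e1] t0 ht]; first exact: powR_gt0.
have ee1 : 1 <= eps `^ (1 - p) by apply: ge1_powRB; rewrite ?e0 ?e1// ltW.
have key : t `^ (1 - th) <= D * eps `^ (1 - p).
  have [t2|t2] := leP 2 t; last first.
    apply: (@le_trans _ _ (2 `^ (1 - th))).
      by apply: ge0_ler_powR; rewrite ?nnegrE ?(ltW d0) ?(ltW t0) ?(ltW t2).
    apply: (@le_trans _ _ D); first by rewrite lerDl mulr_ge0 ?ltW.
    by rewrite ler_peMr// ltW.
  have := ht t2; rewrite powRM ?(ltW z0) ?(ltW e0)//.
  rewrite /phi_k -mulrBl -ler_pdivlMl ?mulr_gt0//.
  rewrite ler_pdivrMr// => h.
  have {h} : t `^ (1 - th) <= 2 `^ (1 - th) + (1 - th) * M * eps `^ (1 - p).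
    rewrite -lerBlDl; apply: le_trans h _.
    by rewrite le_eqVlt; apply/orP; left; apply/eqP; rewrite /M; ring.
  move=> h; apply: le_trans h _; rewrite /D [leRHS]mulrDl lerD2r.
  by rewrite ler_peMr// powR_ge0.
have -> : - ((p - 1)^-1 - gam)^-1 = (1 - p) * (1 - th)^-1.
  by rewrite /th; field; apply/andP; split; apply: lt0r_neq0; move: p0 d0; rewrite /th; lra.
rewrite powRrM -powRM ?powR_ge0 ?(ltW D0)//.
have -> : t = (t `^ (1 - th)) `^ (1 - th)^-1.
  by rewrite -powRrM mulfV ?lt0r_neq0// powRr1// ltW.
apply: ge0_ler_powR => //; first by rewrite invr_ge0 ltW.
  by rewrite nnegrE powR_ge0.
by rewrite nnegrE mulr_ge0 ?powR_ge0// ltW.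
Qed.

Lemma exponential_time p c z : 1 < p -> 0 < c -> 0 < z ->
  exists2 C : R, 0 < C & forall eps t, 0 < eps <= 1 -> 0 < t ->
    (2 <= t -> c * (p - 1) * (ln t - ln 2) <= (z * eps) `^ (1 - p)) ->
    t <= expR (C * eps `^ (- (p - 1))).
Proof.
move=> p1 c0 z0; have p0 : 0 < p - 1 by rewrite subr_gt0.
pose M := z `^ (1 - p) / (c * (p - 1)).
have M0 : 0 < M by rewrite divr_gt0 ?powR_gt0// mulr_gt0.
have l0 : 0 < ln 2 :> R by rewrite ln_gt0// ltr1n.
exists (ln 2 + M) => [|eps t /andP[e0 e1] t0 ht]; first by rewrite addr_gt0.
have ee1 : 1 <= eps `^ (1 - p) by apply: ge1_powRB; rewrite ?e0 ?e1// ltW.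
rewrite opprB -{1}(lnK t0) ler_expR.
have [t2|t2] := leP 2 t; last first.
  apply: (@le_trans _ _ (ln 2)); first by rewrite ler_ln ?posrE// ltW.
  apply: (@le_trans _ _ (ln 2 + M)); first by rewrite lerDl ltW.
  by rewrite ler_peMr// addr_ge0// ltW.
have := ht t2; rewrite powRM ?(ltW z0) ?(ltW e0)// -ler_pdivlMl ?mulr_gt0// => h.
rewrite mulrDl; apply: (@le_trans _ _ (ln 2 + M * eps `^ (1 - p))); last first.
  by rewrite lerD2r ler_peMr// ltW.
rewrite -lerBlDl; apply: le_trans h _.
by rewrite le_eqVlt; apply/orP; left; apply/eqP; rewrite /M; ring.
Qed.

Lemma ereal_le_real (T : \bar R) B : (1 < T)%E ->
  (forall t : R, 1 < t -> (t%:E < T)%E -> t <= B) -> (T <= B%:E)%E.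
Proof.
move=> T1 TB; rewrite leNgt; apply/negP => BT.
pose m := Num.max 1 B.
have mT : (m%:E < T)%E by rewrite /m /Num.max; case: ifP.
have [t mt tT] : exists2 t, m < t & (t%:E < T)%E.
  case: T mT {T1 TB BT} => [x| |]//; last by move=> _; exists (m + 1); rewrite ?ltrDl// ltry.
  rewrite lte_fin => mx; exists ((m + x) / 2); first by rewrite midf_lt.
  by rewrite lte_fin midf_lt.
move: mt; rewrite gt_max => /andP[t1 Bt].
by have := TB t t1 tT; rewrite leNgt Bt.
Qed.

End Riccati.

(** * Uniform difference quotients *)
Section Slices.
Context {R : realType}.

Lemma is_derive_limP (f : R -> R) (t d : R) : is_derive t 1 f d <->
  (fun h => h^-1 * (f (t + h) - f t)) @ (0 : R)^' --> d.
Proof.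
have E : (fun h : R => h^-1 *: ((f \o shift t) (h *: 1) - f t))
  = (fun h => h^-1 * (f (t + h) - f t)).
  by apply/funext => h; rewrite /= -[h%:A]/(h * 1) mulr1 [h + t]addrC.
split=> [[]|fd].
  by rewrite /derivable /derive E => + <-.
split; first by rewrite /derivable E; apply/cvg_ex; exists d.
by rewrite /derive E; exact: (cvg_lim (@Rhausdorff R) fd).
Qed.

Lemma is_derive_at0 (f : R -> R) (t d : R) :
  is_derive (0 : R) 1 (fun h => f (t + h)) d <-> is_derive t 1 f d.
Proof.
rewrite !is_derive_limP.
suff -> : (fun h => h^-1 * (f (t + (0 + h)) - f (t + 0)))
  = (fun h => h^-1 * (f (t + h) - f t)) by [].
by apply/funext => h; rewrite add0r addr0.
Qed.

Lemma derive_remainder (f df : R -> R) (t d e h : R) :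
  (forall s, `|s - t| <= d -> is_derive s 1 f (df s)) ->
  (forall s, `|s - t| <= d -> `|df s - df t| <= e) -> `|h| <= d ->
  `|f (t + h) - f t - h * df t| <= e * `|h|.
Proof.
move=> fd dfe hd.
have near_t s : Num.min t (t + h) <= s <= Num.max t (t + h) -> `|s - t| <= d.
  move=> sth; apply: le_trans hd; have := ler_norm h; have := ler_norm (- h).
  rewrite normrN ler_distl; move: sth; case: (leP t (t + h)); lra.
have cont a b : (forall s, a <= s <= b -> `|s - t| <= d) ->
    {within `[a, b], continuous f}.
  move=> ab; apply: continuous_in_subspaceT => s; rewrite inE/= in_itv/= => sab.
  exact: is_derive_continuous (fd s (ab s sab)).
have [h0|h0] := leP 0 h.
  have st s : t <= s <= t + h -> `|s - t| <= d.
    by move=> sth; apply: near_t; rewrite (min_idPl _) ?(max_idPr _)// lerDl.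
  have [|s||c] := @MVT_segment R f df t (t + h).
  - by rewrite lerDl.
  - by rewrite in_itv/= => /andP[ts sh]; apply/fd/st; rewrite !ltW.
  - exact: cont.
  rewrite in_itv/= => cth ->.
  have -> : df c * (t + h - t) - h * df t = (df c - df t) * h by ring.
  by rewrite normrM ler_wpM2r// dfe// st.
have st s : t + h <= s <= t -> `|s - t| <= d.
  move=> sth; apply: near_t; rewrite (min_idPr _) ?(max_idPl _)//.
  - by rewrite gerDl ltW.
  - by rewrite gerDl ltW.
have [|s||c] := @MVT_segment R f df (t + h) t.
- by rewrite gerDl ltW.
- by rewrite in_itv/= => /andP[ts sh]; apply/fd/st; rewrite !ltW.
- exact: cont.
rewrite in_itv/= => cth fE.
have -> : f (t + h) - f t - h * df t = (df c - df t) * h.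
  by rewrite -[f (t + h) - f t]opprB fE; ring.
by rewrite normrM ler_wpM2r// dfe// st.
Qed.

Lemma is_derive_of_remainder (f : R -> R) (t d : R) :
  (forall e, 0 < e -> \forall h \near (0 : R), `|f (t + h) - f t - h * d| <= e * `|h|) ->
  is_derive t 1 f d.
Proof.
move=> fd; apply/is_derive_limP; apply/cvgrPdist_le => e e0.
have H : \forall h \near 0^', `|f (t + h) - f t - h * d| <= e * `|h|.
  by apply: cvg_within; exact: fd.
near=> h.
have h0 : h != 0 by near: h; exact: nbhs_dnbhs_neq.
have -> : d - h^-1 * (f (t + h) - f t) = - h^-1 * (f (t + h) - f t - h * d).
  by field.
rewrite normrM normrN normfV ler_pdivrMl ?normr_gt0// [leRHS]mulrC.
by near: h; apply: H.
Unshelve. all: by end_near. Qed.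

(** Compactness of K turns pointwise continuity at all points of {a} x K into a
    neighbourhood of a that is uniform over K. *)
Lemma uniform_near_slice (S X : topologicalType) (G : S * X -> R) (a : S)
    (K : set X) (e : R) : compact K -> 0 < e ->
  (forall x, K x -> {for (a, x), continuous G}) ->
  \forall s \near a, forall x, K x -> `|G (s, x) - G (a, x)| <= e.
Proof.
move=> /compact_near_coveringP cK e0 Gc.
apply: (cK S (nbhs a) (fun s x => `|G (s, x) - G (a, x)| <= e)) => x Kx.
have e20 : 0 < e / 2 by rewrite divr_gt0.
have /cvgrPdist_le/(_ _ e20)[[A B]/= [Aa Bx] AB] := Gc x Kx.
exists (B, A) => //= -[x' s]/= [Bx' As].
have h1 := AB (s, x') (conj As Bx').
have h2 := AB (a, x') (conj (nbhs_singleton Aa) Bx').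
rewrite -(subrKA (G (a, x))) (splitr e) (le_trans (ler_normD _ _))//.
by rewrite lerD// distrC.
Qed.

End Slices.

(** * The mean with an exponential weight *)
Section WeightedMean.
Context {R : realType} {n : nat}.
Variable i0 : 'I_n.
Local Notation V := 'rV[R]_n.
Implicit Types (f g : V -> R) (x : V) (rho M c : R).

(** The weight exp(x_i0) satisfies Delta w = w. It replaces the usual average of
    exp(x . omega) over all directions omega: both have the same integral over
    centred balls up to a constant, and only these integrals enter the proof. *)
Definition exp_weight x : R := expR (x 0 i0).

Definition wmean f : R := mean (fun x => f x * exp_weight x).

Lemma bounded_support_weight f :
  bounded_support f -> bounded_support (fun x => f x * exp_weight x).
Proof.
move=> /bounded_supportP[M [rho [M0 rho0 fM f0]]].
exists (M * expR rho), rho => x; split; last by move=> /f0 ->; rewrite mul0r.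
have [xr|/f0 ->] := leP `|x| rho; last first.
  by rewrite mul0r normr0 mulr_ge0// expR_ge0.
rewrite normrM ler_pM// ger0_norm ?expR_ge0// ler_expR.
exact: le_trans (ler_norm _) (le_trans (ler_coord_norm _ _) xr).
Qed.

Lemma wmeanD f g c : bounded_support f -> bounded_support g ->
  wmean (fun x => c * f x + g x) = c * wmean f + wmean g.
Proof.
move=> bf bg; rewrite -meanD; try exact: bounded_support_weight.
by congr mean; apply/funext => x; rewrite mulrDl mulrA.
Qed.

Lemma wmean0 : wmean (fun=> 0) = 0.
Proof. by rewrite -[RHS](@mean0 R n); congr mean; apply/funext => x; rewrite mul0r. Qed.

Lemma wmeanZ f c : bounded_support f -> wmean (fun x => c * f x) = c * wmean f.
Proof.
move=> bf; rewrite -meanZ; last exact: bounded_support_weight.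
by congr mean; apply/funext => x; rewrite mulrA.
Qed.

Lemma bounded_supportZ f c : bounded_support f -> bounded_support (fun x => c * f x).
Proof.
move=> bf; have := bounded_supportD c bf (@bounded_support0 R n).
by under eq_fun do rewrite addr0.
Qed.

Lemma bounded_support_add f g : bounded_support f -> bounded_support g ->
  bounded_support (fun x => f x + g x).
Proof.
move=> bf bg; have := bounded_supportD 1 bf bg.
by under eq_fun do rewrite mul1r.
Qed.

Lemma wmean_add f g : bounded_support f -> bounded_support g ->
  wmean (fun x => f x + g x) = wmean f + wmean g.
Proof.
move=> bf bg; rewrite -[wmean f]mul1r -wmeanD//.
by congr wmean; apply/funext => x; rewrite mul1r.
Qed.

Lemma bounded_support_sum (I : Type) (s : seq I) (f : I -> V -> R) :
  (forall i, bounded_support (f i)) ->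
  bounded_support (fun x => \sum_(i <- s) f i x) /\
  wmean (fun x => \sum_(i <- s) f i x) = \sum_(i <- s) wmean (f i).
Proof.
move=> bf; elim: s => [|j s [bs ws]].
  under eq_fun do rewrite big_nil; split; first exact: bounded_support0.
  by rewrite big_nil wmean0.
under eq_fun do rewrite big_cons; split; first exact: bounded_support_add.
by rewrite big_cons wmean_add// ws.
Qed.

Lemma le_wmean f g : bounded_support f -> bounded_support g ->
  (forall x, f x <= g x) -> wmean f <= wmean g.
Proof.
move=> bf bg fg; apply: le_mean => [| |x]; try exact: bounded_support_weight.
by rewrite ler_wpM2r ?expR_ge0.
Qed.

Lemma wmean_bounded rho : exists2 C : R, 0 < C & forall f M,
  (forall x, `|f x| <= M) -> (forall x, rho < `|x| -> f x = 0) ->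
  `|wmean f| <= C * M.
Proof.
have [C C0 hC] := @mean_bounded R n rho.
exists (C * expR rho) => [|f M fM f0]; first by rewrite mulr_gt0 ?expR_gt0.
rewrite -mulrA; apply: hC => x; last by move=> /f0 ->; rewrite mul0r.
have [xr|/f0 ->] := leP `|x| rho; last first.
  by rewrite mul0r normr0 mulr_ge0 ?expR_ge0// (le_trans _ (fM x)).
rewrite normrM mulrC ler_pM// ger0_norm ?expR_ge0// ler_expR.
exact: le_trans (ler_norm _) (le_trans (ler_coord_norm _ _) xr).
Qed.

Lemma wmean_gt0 f x0 : bounded_support f -> continuous f ->
  (forall x, 0 <= f x) -> 0 < f x0 -> 0 < wmean f.
Proof.
move=> bf cf f0 fx0.
have /cvgrPdist_lt/(_ _ (divr_gt0 fx0 (ltr0Sn R 1)))/nbhs_ballP[d d0 dP] := cf x0.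
have d20 : 0 < d / 2 by rewrite divr_gt0.
apply: (@mean_gt0 _ _ _ x0 (f x0 / 2 * expR (x0 0 i0 - d / 2)) (d / 2)) => //.
- exact: bounded_support_weight.
- by move=> x; rewrite mulr_ge0 ?expR_ge0.
- by rewrite mulr_gt0 ?expR_gt0 ?divr_gt0.
move=> x xd; rewrite ler_pM ?expR_ge0 ?divr_ge0//.
  have := dP x; rewrite -ball_normE/= distrC.
  have xd' : `|x - x0| < d by apply: (le_lt_trans xd); rewrite ltr_pdivrMr// ltr_pMr// ltr1n.
  by move=> /(_ xd')/ltW; rewrite ler_distl => /andP[]; lra.
rewrite ler_expR; have := le_trans (ler_coord_norm (x - x0) i0) xd.
by rewrite !mxE ler_distl => /andP[].
Qed.

Lemma compact_norm_le rho : compact [set x : V | `|x| <= rho].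
Proof.
apply: bounded_closed_compact.
  exists rho; split; first exact: num_real.
  by move=> y ry x /= /le_trans; apply; exact: ltW.
apply: (@closed_comp _ _ (fun x : V => `|x|) [set y | y <= rho]).
  by move=> x _; exact: norm_continuous.
exact: closed_le.
Qed.

Lemma continuous_bounded_support f rho : continuous f ->
  (forall x, rho < `|x| -> f x = 0) -> bounded_support f.
Proof.
move=> cf f0.
have : compact (f @` [set x : V | `|x| <= rho]).
  apply: continuous_compact; last exact: compact_norm_le.
  exact: continuous_subspaceT.
move=> /compact_bounded[M [_ hM]].
exists (Num.max (M + 1) 0), rho => x; split; last exact: f0.
have [xr|/f0 ->] := leP `|x| rho; last by rewrite normr0 le_max lexx orbT.
by rewrite le_max hM// ?ltrDl//; exists x.
Qed.

Lemma exp_weight_line x (j : 'I_n) (s : R) :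
  exp_weight (x + s *: delta_mx 0 j) = exp_weight x * expR (s * (j == i0)%:R).
Proof. by rewrite /exp_weight !mxE eqxx/= expRD eq_sym. Qed.

Lemma is_derive_line f g (j : 'I_n) :
  (forall x, is_derive (0 : R) 1 (fun h => f (x + h *: delta_mx 0 j)) (g x)) ->
  forall x (s : R), is_derive s 1 (fun h : R => f (x + h *: delta_mx 0 j))
     (g (x + s *: delta_mx 0 j)).
Proof.
move=> fg x s; apply/is_derive_at0.
suff -> : (fun h => f (x + (s + h) *: delta_mx 0 j))
  = (fun h => f (x + s *: delta_mx 0 j + h *: delta_mx 0 j)) by exact: fg.
by apply/funext => h; rewrite scalerDl addrA.
Qed.

Lemma continuous_line f (j : 'I_n) x : continuous f ->
  {for ((0 : R), x), continuous (fun z : R * V => f (z.2 + z.1 *: delta_mx 0 j))}.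
Proof.
move=> cf; apply: continuous_comp; last exact: cf.
apply: continuousD; first exact: cvg_snd.
by apply: cvgZ; [exact: cvg_fst|exact: cvg_cst].
Qed.

(** Integration by parts against the weight, whose derivative in direction j is
    (j == i0) times the weight: the derivative of f times the weight has mean zero. *)
Lemma wmean_by_parts f g (j : 'I_n) : bounded_support f -> bounded_support g ->
  continuous f -> continuous g ->
  (forall x, is_derive (0 : R) 1 (fun h => f (x + h *: delta_mx 0 j)) (g x)) ->
  wmean g = - (j == i0)%:R * wmean f.
Proof.
move=> bf bg cf cg fg.
set c : R := (j == i0)%:R.
suff : wmean (fun x => c * f x + g x) = 0.
  by rewrite wmeanD// => /eqP; rewrite addrC addr_eq0 mulNr => /eqP.
have bq := bounded_supportD c bf bg.
have fw := bounded_support_weight bf.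
apply: (@mean_derive0 _ _ (fun x => f x * exp_weight x) _ j) => //.
  exact: bounded_support_weight.
have dfw : forall x, is_derive (0 : R) 1
    (fun h => f (x + h *: delta_mx 0 j) * exp_weight (x + h *: delta_mx 0 j))
    ((c * f x + g x) * exp_weight x).
  move=> x; have dw : is_derive (0 : R) 1
      (fun h => exp_weight (x + h *: delta_mx 0 j)) (exp_weight x * c).
    under eq_fun do rewrite exp_weight_line.
    have := is_derive_mul (is_derive_const (exp_weight x) (0 : R)) (is_derive_exp
      (is_derive_mul (is_derive_ident (0 : R)) (is_derive_const c 0))).
    by move=> dd; apply: is_derive_eq dd _; rewrite !mul0r expR0 /c; ring.
  by apply: is_derive_eq (is_derive_mul (fg x) dw) _; rewrite scale0r addr0; ring.
have cw : continuous exp_weight.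
  move=> x; apply: continuous_comp; last exact: continuous_expR.
  exact: coord_continuous.
have cq : continuous (fun x => (c * f x + g x) * exp_weight x).
  move=> x; have ccf := continuousM (@cst_continuous V R c x) (cf x).
  exact: (continuousM (continuousD ccf (cg x)) (cw x)).
have [Mf [rf [Mf0 rf0 fM f0]]] := bounded_supportP fw.
have [Mg [rg [Mg0 rg0 gM g0]]] := bounded_supportP (bounded_support_weight bq).
pose r := Num.max rf rg + 1.
move=> e e0.
have := uniform_near_slice (compact_norm_le (rho := r)) e0
  (fun x _ => continuous_line (j := j) (x := x) cq).
move=> /nbhs_ballP[d d0 dP]; apply/nbhs_ballP; exists (Num.min 1 (d / 2)) => /=.
  by rewrite lt_min ltr01 divr_gt0.
move=> h; rewrite /ball/= sub0r normrN lt_min => /andP[h1 hd] x.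
have [xr|xr] := leP `|x| r.
  have := @derive_remainder _
    (fun s => f (x + s *: delta_mx 0 j) * exp_weight (x + s *: delta_mx 0 j))
    (fun s => (c * f (x + s *: delta_mx 0 j) + g (x + s *: delta_mx 0 j))
              * exp_weight (x + s *: delta_mx 0 j)) 0 (d / 2) e h.
  rewrite add0r scale0r addr0; apply; last exact: ltW.
  - move=> s _; exact: (@is_derive_line (fun y => f y * exp_weight y)
      (fun y => (c * f y + g y) * exp_weight y) j dfw x s).
  - move=> s; rewrite subr0 => sd.
    have := dP s; rewrite /ball/= sub0r normrN => /(_ _ x xr).
    rewrite /= scale0r addr0; apply.
    by apply: le_lt_trans sd _; rewrite ltr_pdivrMr// ltr_pMr// ltr1n.
have big : Num.max rf rg < `|x + h *: delta_mx 0 j|.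
  by apply: norm_step_gt => //; exact: ltW.
have xr' : Num.max rf rg < `|x| by apply: lt_trans xr; rewrite ltrDl.
move: big xr'; rewrite !gt_max => /andP[/f0 -> _] /andP[/f0 -> /g0 ->].
by rewrite mulr0 !subr0 normr0 mulr_ge0// ltW.
Qed.

End WeightedMean.

(** * Jensen inequality and weighted mass of a ball *)
Section BallMass.
Context {R : realType} {n : nat}.
Variable i0 : 'I_n.
Local Notation V := 'rV[R]_n.
Implicit Types (f g : V -> R) (x : V) (rho M c p B : R).

Lemma powR_tangent p (s y : R) : 1 < p -> 0 < s ->
  p * s `^ (p - 1) * y - (p - 1) * s `^ p <= `|y| `^ p.
Proof.
move=> p1 s0; have p0 : 0 < p := lt_trans ltr01 p1.
have p10 : 0 < p - 1 by rewrite subr_gt0.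
have q0 : 0 < p / (p - 1) by rewrite divr_gt0.
have pq : p^-1 + (p / (p - 1))^-1 = 1.
  by field; rewrite !lt0r_neq0.
have := conjugate_powR (normr_ge0 y) (powR_ge0 s (p - 1)) p0 q0 pq.
rewrite -powRrM.
have -> : (p - 1) * (p / (p - 1)) = p by field; rewrite lt0r_neq0.
have -> : s `^ p / (p / (p - 1)) = s `^ p * (p - 1) / p by field; rewrite !lt0r_neq0.
rewrite -mulrDl ler_pdivlMr// => h.
rewrite lerBlDr; apply: (@le_trans _ _ (`|y| * s `^ (p - 1) * p)); last first.
  by rewrite [(p - 1) * _]mulrC.
have -> : p * s `^ (p - 1) * y = y * s `^ (p - 1) * p by ring.
by rewrite !ler_wpM2r ?powR_ge0 ?ler_norm ?(ltW p0).
Qed.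

(** Integrate the tangent inequality for |y|^p at the point s = mean f / B; this
    is the choice of s that maximizes the resulting lower bound. *)
Lemma wmean_jensen f (P : pred V) p B : 1 < p -> bounded_support f ->
  bounded_support (fun x => `|f x| `^ p) ->
  bounded_support (fun x => (P x)%:R) ->
  (forall x, ~~ P x -> f x = 0) ->
  0 < B -> wmean i0 (fun x => (P x)%:R) <= B -> 0 < wmean i0 f ->
  wmean i0 f * (wmean i0 f / B) `^ (p - 1) <= wmean i0 (fun x => `|f x| `^ p).
Proof.
move=> p1 bf bfp bP f0 B0 PB U0.
have p10 : 0 < p - 1 by rewrite subr_gt0.
set U := wmean i0 f; set s := U / B.
have s0 : 0 < s by rewrite divr_gt0.
have sp : s `^ p = s * s `^ (p - 1) by rewrite mulr_powRB1 ?(ltW s0)// (lt_trans ltr01).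
apply: (@le_trans _ _ (wmean i0 (fun x => (p * s `^ (p - 1)) * f x
    + (- ((p - 1) * s `^ p)) * (P x)%:R))); last first.
  apply: le_wmean => //; first by apply: bounded_supportD => //; exact: bounded_supportZ.
  move=> x; case: (boolP (P x)) => Px; last first.
    by rewrite f0// !mulr0 addr0 powR_ge0.
  by rewrite mulr1; exact: powR_tangent.
rewrite wmeanD//; last exact: bounded_supportZ.
rewrite wmeanZ// -/U mulNr.
apply: (@le_trans _ _ (p * s `^ (p - 1) * U - (p - 1) * s `^ p * B)); last first.
  by rewrite lerD2l lerN2 ler_wpM2l// mulr_ge0 ?powR_ge0// ltW.
have -> : U = s * B by rewrite /s divfK// lt0r_neq0.
by rewrite sp le_eqVlt; apply/orP; left; apply/eqP; ring.
Qed.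

Lemma norm_le_enorm x : `|x| <= enorm x.
Proof.
rewrite leNgt; apply/negP => /(ltr_norm_coord (sqrtr_ge0 _))[i].
rewrite ltNge => /negP; apply.
rewrite -sqrtr_sqr /enorm ler_wsqrtr// (bigD1 i)//= lerDl.
by apply: sumr_ge0 => j _; exact: sqr_ge0.
Qed.

Lemma bounded_support_ball rho : bounded_support (fun x : V => (enorm x <= rho)%R%:R).
Proof.
exists 1, rho => x; split; first by case: (enorm x <= rho); rewrite ?normr1 ?normr0.
by move=> /lt_le_trans /(_ (norm_le_enorm x)); rewrite ltNge => /negbTE ->.
Qed.

(** Let x0 be the coordinate of index i0. On the ball the other coordinates
    satisfy sum x_i^2 <= rho^2 - x0^2 <= 2 rho (rho - x0), so half of the deficit
    rho - x0 pays for the sum of the x_i^2 / (4 rho), and each of these terms is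
    at least |x_i| / sqrt rho - 1. The bound is a product of functions of a single
    coordinate with width 2 in direction i0 and width sqrt rho in the others. *)
Lemma exp_weight_ball_le x rho : 0 < rho -> enorm x <= rho ->
  exp_weight i0 x <= expR (rho + n%:R) *
    \prod_i expR (- `|x 0 i - (if i == i0 then rho else 0)|
                    / (if i == i0 then 2 else Num.sqrt rho)).
Proof.
move=> rho0 xrho; have q0 : 0 < Num.sqrt rho by rewrite sqrtr_gt0.
have qq : Num.sqrt rho ^+ 2 = rho by rewrite sqr_sqrtr// ltW.
rewrite -expR_sum -expRD ler_expR (bigD1 i0)//= eqxx.
pose S := \sum_(i < n | i != i0) x 0 i ^+ 2.
have S0 : 0 <= S by apply: sumr_ge0 => i _; exact: sqr_ge0.
have xS : x 0 i0 ^+ 2 + S <= rho ^+ 2.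
  have <- : \sum_i x 0 i ^+ 2 = x 0 i0 ^+ 2 + S by rewrite (bigD1 i0).
  rewrite -[leLHS]sqr_sqrtr; last by apply: sumr_ge0 => i _; exact: sqr_ge0.
  by rewrite lerXn2r// nnegrE ?sqrtr_ge0// ltW.
have x0r : x 0 i0 <= rho.
  have : `|x 0 i0| <= rho by exact: le_trans (ler_coord_norm _ _) (le_trans (norm_le_enorm _) xrho).
  exact: le_trans (ler_norm _).
have -> : - `|x 0 i0 - rho| = x 0 i0 - rho by rewrite ler0_norm ?subr_le0// opprK.
have : - (n%:R + S / (4 * rho)) <=
    \sum_(i < n | i != i0) - `|x 0 i - (if i == i0 then rho else 0)| / (if i == i0 then 2 else Num.sqrt rho).
  apply: (@le_trans _ _ (\sum_(i < n | i != i0) (- 1 - x 0 i ^+ 2 / (4 * rho)))); last first.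
    apply: ler_sum => i /negbTE ->; rewrite subr0 -[X in _ / (4 * X)]qq.
    rewrite -(ler_pM2r (exprn_gt0 2 q0)) -[x 0 i ^+ 2]real_normK ?num_real//.
    move: `|x 0 i| (Num.sqrt rho) q0 => y q q0.
    have -> : (- 1 - y ^+ 2 / (4 * q ^+ 2)) * q ^+ 2 = - q ^+ 2 - y ^+ 2 / 4.
      by field; rewrite lt0r_neq0.
    have -> : - y / q * q ^+ 2 = - y * q by field; rewrite lt0r_neq0.
    have := sqr_ge0 (y / 2 - q); rewrite sqrrB; lra.
  rewrite big_split/= !sumrN -mulr_suml -/S opprD lerD2r lerN2.
  rewrite sumr_const -[_ *+ _]/(#|_|%:R) ler_nat.
  by apply: leq_trans (max_card _) _; rewrite card_ord.
have : S / (4 * rho) <= (rho - x 0 i0) / 2.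
  rewrite ler_pdivrMr ?mulr_gt0//.
  have -> : (rho - x 0 i0) / 2 * (4 * rho) = 2 * rho * (rho - x 0 i0) by field.
  nra.
by move: (\sum_(i | _) _) (S / _) => a b; lra.
Qed.

(** The exponent (n - 1)/2 comes from the n - 1 transversal directions, each of
    width sqrt rho. This is the sharp growth of the weighted mass, and it fixes the
    critical exponent. *)
Lemma wmean_ball_le (r : R) : 0 < r -> exists2 K, 0 < K & forall rho, r <= rho ->
  wmean i0 (fun x => (enorm x <= rho)%R%:R)
    <= K * (expR rho * rho `^ ((n%:R - 1) / 2)).
Proof.
move=> r0; pose c := 2 * expR (Num.sqrt r)^-1 : R.
have c0 : 0 < c by rewrite mulr_gt0// expR_gt0.
exists (expR n%:R * (2 * 2 * expR 2^-1) * c ^+ n.-1) => [|rho rrho].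
  by rewrite !mulr_gt0 ?expR_gt0 ?exprn_gt0.
have rho0 : 0 < rho := lt_le_trans r0 rrho.
have q0 : 0 < Num.sqrt rho by rewrite sqrtr_gt0.
pose a i := if i == i0 then rho else 0.
pose b (i : 'I_n) := if i == i0 then 2 else Num.sqrt rho.
apply: (@le_trans _ _ (expR (rho + n%:R) * \prod_i (2 * b i * expR (b i)^-1))).
  apply: (@mean_le_prod _ _ _ _ a).
  - by apply: bounded_support_weight; exact: bounded_support_ball.
  - by move=> i; rewrite /b; case: ifP.
  - exact: expR_ge0.
  - move=> x; case: (boolP (enorm x <= rho)) => xr.
      by rewrite mul1r; exact: exp_weight_ball_le.
    by rewrite mul0r mulr_ge0 ?expR_ge0// prodr_ge0// => i _; exact: expR_ge0.
rewrite (bigD1 i0)//= {1 2}/b eqxx.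
have -> : (\prod_(i < n | i != i0) (2 * b i * expR (b i)^-1))
    = (2 * Num.sqrt rho * expR (Num.sqrt rho)^-1) ^+ n.-1.
  have -> : n.-1 = #|[pred i : 'I_n | i != i0]|.
    by rewrite -[n in LHS]card_ord (cardC1 i0).
  rewrite -prodr_const; apply: eq_bigr => i /negbTE; by rewrite /b => ->.
have -> : rho `^ ((n%:R - 1) / 2) = Num.sqrt rho ^+ n.-1.
  rewrite -powR12_sqrt ?(ltW rho0)// -powR_mulrn ?powR_ge0// -powRrM.
  congr (_ `^ _); rewrite -subn1 natrB; last by case: (n) i0 => [[]|].
  by rewrite mulrC.
rewrite expRD.
have -> : expR n%:R * (2 * 2 * expR 2^-1) * c ^+ n.-1 * (expR rho * Num.sqrt rho ^+ n.-1)
  = expR rho * expR n%:R * (2 * 2 * expR 2^-1 * ((c * Num.sqrt rho) ^+ n.-1)).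
  rewrite [(c * _) ^+ _]exprMn.
  by move: (c ^+ n.-1) (Num.sqrt rho ^+ n.-1) (expR rho) (expR n%:R) (expR 2^-1) => a1 a2 a3 a4 a5; ring.
rewrite ler_wpM2l ?mulr_ge0 ?expR_ge0// ler_wpM2l ?mulr_ge0 ?expR_ge0//.
apply: lerXn2r; rewrite ?nnegrE.
- by rewrite !mulr_ge0 ?expR_ge0 ?sqrtr_ge0.
- by rewrite mulr_ge0 ?(ltW c0) ?sqrtr_ge0.
rewrite /c mulrAC ler_wpM2r ?sqrtr_ge0// ler_wpM2l// ler_expR.
by rewrite lef_pV2 ?posrE ?sqrtr_gt0// ler_wsqrtr.
Qed.

End BallMass.

(** * Averages over space of functions on a slab *)
Section SlabCalculus.
Context {R : realType} {n : nat}.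
Variable T : \bar R.
Hypothesis T1 : (1 < T)%E.
Local Notation V := 'rV[R]_n.
Local Notation ST := (R * 'rV[R]_n)%type.
Implicit Types (g : ST -> R) (x : V) (t s h : R).

Lemma le_lt_lifespan s t : s <= t -> (t%:E < T)%E -> (s%:E < T)%E.
Proof. by move=> st; apply: le_lt_trans; rewrite lee_fin. Qed.

Lemma lifespan_gap t : (t%:E < T)%E -> exists2 t', t < t' & (t'%:E < T)%E.
Proof.
case: T => [y| |]//; last by move=> _; exists (t + 1); rewrite ?ltrDl// ltry.
by rewrite lte_fin => ty; exists ((t + y) / 2); rewrite ?lte_fin midf_lt.
Qed.

Lemma time_step t x h : (t, x) + h *: (dir_t : ST) = (t + h, x).
Proof. by congr pair; rewrite /= ?[h%:A]mulr1 ?scaler0 ?addr0. Qed.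

Lemma space_step t x h (i : 'I_n) :
  (t, x) + h *: (dir_x i : ST) = (t, x + h *: delta_mx 0 i).
Proof. by congr pair; rewrite /= scaler0 addr0. Qed.

Lemma within_dnbhs_near (D : set R) : (\forall h \near (0 : R), D h) ->
  within D (0 : R)^' = (0 : R)^'.
Proof.
move=> D0; apply/seteqP; split => P; rewrite /within/= => PD; last first.
  by move: PD; apply: filterS => h Ph _.
have D0' : \forall h \near 0^', D h by exact: cvg_within.
by move: D0' PD; apply: filterS2 => h Dh; apply.
Qed.

Lemma derive_in_line (D : set ST) g (z v : ST) :
  (\forall h \near (0 : R), D (z + h *: v)) -> derivable_in D g z v ->
  is_derive (0 : R) 1 (fun h : R => g (z + h *: v)) (derive_in D g v z).
Proof.
move=> Dz; rewrite /derivable_in /derive_in (within_dnbhs_near Dz) => dg.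
apply/is_derive_limP.
suff -> : (fun h => h^-1 * (g (z + (0 + h) *: v) - g (z + 0 *: v)))
  = (fun h => h^-1 *: (g (z + h *: v) - g z)) by [].
by apply/funext => h; rewrite add0r scale0r addr0.
Qed.

Lemma near_slab t x : 1 < t -> (t%:E < T)%E ->
  \forall h \near (0 : R), slab T ((t, x) + h *: (dir_t : ST)).
Proof.
move=> t1 tT; have [t' tt' t'T] := lifespan_gap tT.
have d0 : 0 < Num.min (t - 1) (t' - t) by rewrite lt_min !subr_gt0 t1.
apply/nbhs_ballP; exists (Num.min (t - 1) (t' - t)) => //= h.
rewrite /ball/= sub0r normrN lt_min !ltr_norml => /andP[/andP[h1 h2] /andP[h3 h4]].
rewrite time_step; split => /=; first by lra.
by apply: le_lt_lifespan t'T; lra.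
Qed.

Lemma Dt_is_derive g t x : 1 < t -> (t%:E < T)%E ->
  derivable_in (slab T) g (t, x) dir_t ->
  is_derive t 1 (fun s => g (s, x)) (Dt T g (t, x)).
Proof.
move=> t1 tT dg; apply/is_derive_at0.
have := derive_in_line (near_slab x t1 tT) dg.
by under eq_fun do rewrite time_step.
Qed.

Lemma Dx_is_derive g t x (i : 'I_n) : 1 <= t -> (t%:E < T)%E ->
  derivable_in (slab T) g (t, x) (dir_x i) ->
  is_derive (0 : R) 1 (fun h => g (t, x + h *: delta_mx 0 i)) (Dx T i g (t, x)).
Proof.
move=> t1 tT dg.
have near0 : \forall h \near (0 : R), slab T ((t, x) + h *: (dir_x i : ST)).
  by apply/nbhs_ballP; exists 1 => //= h _; rewrite space_step.
have := derive_in_line near0 dg.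
by under eq_fun do rewrite space_step.
Qed.

(** The bound rho may depend on t1: a support inside the expanding light cone is
    the case of interest. *)
Definition space_compact g := forall t1, 1 <= t1 -> (t1%:E < T)%E ->
  exists rho, forall t x, 1 <= t <= t1 -> rho < `|x| -> g (t, x) = 0.

Lemma derive_in_eq0 (D : set ST) g (z v : ST) :
  ProperFilter (within [set h | D (z + h *: v)] (0 : R)^') ->
  (\forall h \near (0 : R), D (z + h *: v) -> g (z + h *: v) = 0) -> g z = 0 ->
  derive_in D g v z = 0.
Proof.
move=> PF g0 gz; apply: (cvg_lim (@Rhausdorff R)).
apply: cvg_near_cst.
have g0' : \forall h \near 0^', D (z + h *: v) -> g (z + h *: v) = 0.
  by apply: cvg_within.
move: g0'; rewrite /within; apply: filterS => h gh /gh ->.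
by rewrite gz subrr scaler0.
Qed.

Lemma time_within_proper t x : 1 <= t -> (t%:E < T)%E ->
  ProperFilter (within [set h | slab T ((t, x) + h *: (dir_t : ST))] (0 : R)^').
Proof.
move=> t1 tT; apply: Build_ProperFilter_ex => P.
rewrite /within /= => /nbhs_ballP[d d0 dP].
have [t' tt' t'T] := lifespan_gap tT.
pose h := Num.min (d / 2) (t' - t).
have h0 : 0 < h by rewrite lt_min divr_gt0//= subr_gt0.
exists h; apply: dP.
- rewrite /ball/= sub0r normrN gtr0_norm// /h gt_min; apply/orP; left.
  by rewrite ltr_pdivrMr// ltr_pMr// ltr1n.
- by rewrite /= gt_eqF.
rewrite time_step; split => /=; first by rewrite (le_trans t1)// lerDl ltW.
apply: le_lt_lifespan t'T; rewrite -lerBrDl /h ge_min lexx orbT//.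
Qed.

Lemma space_compact_Dt g : space_compact g -> space_compact (Dt T g).
Proof.
move=> sg t1 t11 t1T; have [t' tt' t'T] := lifespan_gap t1T.
have [rho hrho] := sg t' (le_trans t11 (ltW tt')) t'T.
exists rho => t x /andP[t1' tt1] xr; apply: derive_in_eq0.
- by apply: time_within_proper => //; exact: le_lt_lifespan t1T.
- have d0 : 0 < t' - t1 by rewrite subr_gt0.
  apply/nbhs_ballP; exists (t' - t1) => //= h.
  rewrite /ball/= sub0r normrN ltr_norml => /andP[_ hd].
  rewrite time_step => -[/= th _]; apply: hrho => //.
  by rewrite th/=; lra.
- by apply: hrho => //; rewrite t1'/= (le_trans tt1)// ltW.
Qed.

Lemma space_compact_Dx g (i : 'I_n) : space_compact g -> space_compact (Dx T i g).
Proof.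
move=> sg t1 t11 t1T; have [rho hrho] := sg t1 t11 t1T.
exists rho => t x tt1 xr; have /andP[t1' tt1'] := tt1; apply: derive_in_eq0.
- rewrite within_dnbhs_near; first exact: Proper_dnbhs_numFieldType.
  apply/nbhs_ballP; exists 1; first exact: ltr01.
  move=> h _; rewrite /mkset space_step; split => //=.
  exact: le_lt_lifespan t1T.
- have d0 : 0 < `|x| - rho by rewrite subr_gt0.
  apply/nbhs_ballP; exists (`|x| - rho) => //= h.
  rewrite /ball/= sub0r normrN => hd; rewrite space_step => _; apply: hrho => //.
  have := ler_normB (x + h *: delta_mx 0 i) (h *: delta_mx 0 i).
  rewrite addrK; have := norm_delta_le i h; move: hd.
  move: `|x| `|h| `|h *: _| `|_ + _| => a b c d; lra.
- exact: hrho.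
Qed.

(** Clamping the time at 1 extends g to earlier times. The extension is continuous
    in the ordinary, two-sided sense also at t = 1, where the slab ends. *)
Definition slice g t x : R := g (Num.max 1 t, x).

Lemma sliceE g t : 1 <= t -> slice g t = fun x => g (t, x).
Proof. by move=> t1; apply/funext => x; rewrite /slice (max_idPr t1). Qed.

Lemma max1_lt_lifespan t : (t%:E < T)%E -> ((Num.max 1 t)%:E < T)%E.
Proof. by move=> tT; rewrite /Num.max; case: ifP. Qed.

Lemma continuous_max1 t : {for t, continuous (fun s : R => Num.max 1 s)}.
Proof.
apply/cvgrPdist_le => e e0; near=> s.
have : `|t - s| <= e.
  by near: s; have /cvgrPdist_le := @cvg_id _ (nbhs t); apply.
rewrite !ler_distl /Num.max.
by case: (ltP 1 t); case: (ltP 1 s); lra.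
Unshelve. all: by end_near. Qed.

Lemma clamp_continuous g t x : {within slab T, continuous g} -> (t%:E < T)%E ->
  {for (t, x), continuous (fun z : ST => g (Num.max 1 z.1, z.2))}.
Proof.
move=> /subspace_continuousP cg tT.
have sz : slab T (Num.max 1 t, x).
  by split; [rewrite /= le_max lexx|exact: max1_lt_lifespan].
apply: cvg_trans (cg _ sz); rewrite /continuous_at.
have clampc : (fun z : ST => (Num.max 1 z.1, z.2)) @ (t, x) --> (Num.max 1 t, x).
  have maxc : (fun z : ST => Num.max 1 z.1) @ (t, x) --> Num.max 1 t.
    apply: (@continuous_comp _ _ _ (fst : ST -> R) (fun s => Num.max 1 s) (t, x)).
      exact: cvg_fst.
    exact: continuous_max1.
  exact: (cvg_pair maxc cvg_snd).
move=> A /=; rewrite /within /= => gA.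
have := clampc _ gA; rewrite /nbhs/= => h1.
have h2 : \forall z \near (t, x), slab T (Num.max 1 z.1, z.2).
  have [t' tt' t'T] := lifespan_gap tT.
  exists ([set s | s < t'], setT); first by split; [exact: lt_nbhsl|exact: filterT].
  move=> [s y] [/= st' _]; split => /=; first by rewrite le_max lexx.
  by apply: max1_lt_lifespan; exact: le_lt_lifespan (ltW st') t'T.
by apply: filterS2 h1 h2 => z; exact.
Qed.

Lemma slice_continuous g t : {within slab T, continuous g} -> (t%:E < T)%E ->
  continuous (slice g t).
Proof.
move=> cg tT; suff H (x : V) : {for x, continuous (slice g t)} by move=> x; exact: H.
apply: (@continuous_comp _ _ _ (fun y : V => (t, y)) (fun z : ST => g (Num.max 1 z.1, z.2)) x).
  have c1 : (fun _ : V => t) @ x --> t by exact: cst_continuous.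
  have c2 : (fun y : V => y) @ x --> x by exact: cvg_id.
  exact: (cvg_pair c1 c2).
exact: clamp_continuous.
Qed.

Lemma slice_support g t1 : space_compact g -> (t1%:E < T)%E ->
  exists rho, forall t x, t <= t1 -> rho < `|x| -> slice g t x = 0.
Proof.
move=> sg t1T.
have [|rho hrho] := sg (Num.max 1 t1) _ (max1_lt_lifespan t1T).
  by rewrite le_max lexx.
exists rho => t x tt1; apply: hrho.
by rewrite le_max lexx/= ge_max !le_max lexx tt1 orbT.
Qed.

Lemma slice_bounded_support g t : {within slab T, continuous g} ->
  space_compact g -> (t%:E < T)%E -> bounded_support (slice g t).
Proof.
move=> cg sg tT; have [rho hrho] := slice_support sg tT.
apply: (@continuous_bounded_support _ _ _ rho); first exact: slice_continuous.
by move=> x; exact: hrho.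
Qed.

Variable i0 : 'I_n.

(** On a neighbourhood of t all slices vanish outside a common ball, on which they
    converge uniformly. *)
Lemma wmean_slice_continuous g t : {within slab T, continuous g} ->
  space_compact g -> (t%:E < T)%E ->
  {for t, continuous (fun s => wmean i0 (slice g s))}.
Proof.
move=> cg sg tT; have [t' tt' t'T] := lifespan_gap tT.
have [rho hrho] := slice_support sg t'T.
have [C C0 hC] := wmean_bounded i0 rho.
apply/cvgrPdist_le => e e0.
have eC : 0 < e / C by rewrite divr_gt0.
have := uniform_near_slice (compact_norm_le (rho := rho)) eC
  (fun x _ => clamp_continuous (x := x) cg tT).
move=> H; near=> s.
have st' : s < t' by near: s; exact: lt_nbhsl.
have sT := le_lt_lifespan (ltW st') t'T.
rewrite distrC; have -> : wmean i0 (slice g s) - wmean i0 (slice g t)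
    = wmean i0 (fun x => -1 * slice g t x + slice g s x).
  rewrite wmeanD; try exact: slice_bounded_support.
  by rewrite mulN1r addrC.
have -> : e = C * (e / C) by rewrite mulrCA mulfV ?mulr1// lt0r_neq0.
apply: hC => x; last first.
  by move=> xr; rewrite !hrho// ?mulr0 ?addr0// ltW.
have [xr|xr] := leP `|x| rho; last first.
  by rewrite !hrho ?mulr0 ?addr0 ?normr0 ?(ltW eC)// ltW.
rewrite mulN1r addrC; move: x xr; near: s; exact: H.
Unshelve. all: by end_near. Qed.

(** The mean value theorem bounds the remainder of the difference quotient by the
    oscillation of the time derivative, which is uniformly small on the common
    support. *)
Lemma wmean_slice_derive g t :
  {within slab T, continuous g} -> {within slab T, continuous (Dt T g)} ->
  (forall z, slab T z -> derivable_in (slab T) g z dir_t) ->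
  space_compact g -> 1 < t -> (t%:E < T)%E ->
  is_derive t 1 (fun s => wmean i0 (slice g s)) (wmean i0 (slice (Dt T g) t)).
Proof.
move=> cg cdg dg sg t1 tT; have sdg := space_compact_Dt sg.
have [t' tt' t'T] := lifespan_gap tT.
have [rho1 hrho1] := slice_support sg t'T.
have [rho2 hrho2] := slice_support sdg t'T.
pose rho := Num.max rho1 rho2.
have [C C0 hC] := wmean_bounded i0 rho.
apply: is_derive_of_remainder => e e0.
have eC : 0 < e / C by rewrite divr_gt0.
have := uniform_near_slice (compact_norm_le (rho := rho)) eC
  (fun x _ => clamp_continuous (x := x) cdg tT).
move=> /nbhs_ballP[d d0 dP].
pose m := Num.min (d / 2) (Num.min ((t - 1) / 2) ((t' - t) / 2)).
have m0 : 0 < m by rewrite !lt_min !divr_gt0//= subr_gt0.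
apply/nbhs_ballP; exists m => //= h; rewrite /ball/= sub0r normrN => hm.
have near_t s : `|s - t| <= m -> [/\ ball t d s, 1 < s & s < t'].
  rewrite !le_min => /and3P[s1 s2 s3]; split.
  - rewrite -ball_normE/= distrC; apply: (le_lt_trans s1).
    by rewrite ltr_pdivrMr// ltr_pMr// ltr1n.
  - by move: s2; rewrite ler_distl => /andP[]; lra.
  - by move: s3; rewrite ler_distl => /andP[]; lra.
have [_ th1 tht'] : [/\ ball t d (t + h), 1 < t + h & t + h < t'].
  by apply: near_t; rewrite addrAC subrr add0r ltW.
have thT := le_lt_lifespan (ltW tht') t'T.
have -> : wmean i0 (slice g (t + h)) - wmean i0 (slice g t) - h * wmean i0 (slice (Dt T g) t)
  = wmean i0 (fun x => - h * slice (Dt T g) t x + (-1 * slice g t x + slice g (t + h) x)).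
  have b1 := slice_bounded_support cg sg tT.
  have b2 := slice_bounded_support cg sg thT.
  have b3 := slice_bounded_support cdg sdg tT.
  by rewrite wmeanD ?wmeanD//; [ring|exact: bounded_supportD].
have -> : e * `|h| = C * (e / C * `|h|) by field; rewrite lt0r_neq0.
apply: hC => x; last first.
  rewrite /rho gt_max => /andP[x1 x2].
  by rewrite !hrho1 ?hrho2 ?mulr0 ?addr0// ltW.
have [xr|] := leP `|x| rho; last first.
  rewrite /rho gt_max => /andP[x1 x2].
  rewrite (hrho1 _ _ (ltW tt') x1) (hrho1 _ _ (ltW tht') x1) (hrho2 _ _ (ltW tt') x2).
  by rewrite !mulr0 !addr0 normr0 mulr_ge0 ?(ltW eC).
have -> : - h * slice (Dt T g) t x + (-1 * slice g t x + slice g (t + h) x)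
  = slice g (t + h) x - slice g t x - h * slice (Dt T g) t x by ring.
apply: (@derive_remainder _ (fun s => slice g s x) (fun s => slice (Dt T g) s x) t m).
- move=> s /near_t[_ s1 st']; have sT := le_lt_lifespan (ltW st') t'T.
  rewrite (sliceE _ (ltW s1)).
  have := Dt_is_derive s1 sT (dg (s, x) (conj (ltW s1) sT)).
  apply: near_eq_is_derive.
  near=> q; rewrite sliceE//; apply: ltW; near: q; exact: lt_nbhsr.
- move=> s /near_t[sd _ _]; exact: dP.
- exact: ltW.
Unshelve. all: by end_near. Qed.

End SlabCalculus.

Lemma powR2_lt1 (R : realType) (k : R) : k < 1 -> 2 `^ (k - 1) < 1 :> R.
Proof.
move=> k1; rewrite -opprB powRN invf_lt1 ?powR_gt0//.
have k10 : 0 < 1 - k by rewrite subr_gt0.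
have e1 : 1 = 1 `^ (1 - k) by rewrite powR1.
rewrite [ltLHS]e1; apply: gt0_ltr_powR => //.
- by rewrite nnegrE.
- by rewrite nnegrE.
- by rewrite ltr1n.
Qed.

(** * The average of a solution *)
Section Solution.
Context {R : realType} {n : nat}.
Local Notation V := 'rV[R]_n.
Local Notation ST := (R * 'rV[R]_n)%type.
Implicit Types (g : ST -> R) (t s : R) (x : V).
Variables (k p r eps : R) (u0 u1 : V -> R) (T : \bar R) (u : ST -> R).
Variable i0 : 'I_n.
Hypothesis k01 : 0 < k < 1.
Hypothesis p1 : 1 < p.
Hypothesis T1 : (1 < T)%E.
Hypothesis solu : solution k p eps u0 u1 T u.
Hypothesis cone : supp_cone k r T u.

Let v := Dt T u.
Let ltT := le_lt_lifespan (T := T).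

Let cu : {within slab T, continuous u}.
Proof. by case: solu => -[]. Qed.

Let reg1 (d : ST) : spacetime_dir d ->
  (forall z, slab T z -> derivable_in (slab T) u z d) /\
  {within slab T, continuous (derive_in (slab T) u d)}.
Proof.
by case: solu => -[_ ureg] _ _ _ /ureg[ud [udc _]].
Qed.

Let reg2 (d d' : ST) : spacetime_dir d -> spacetime_dir d' ->
  (forall z, slab T z -> derivable_in (slab T) (derive_in (slab T) u d) z d') /\
  {within slab T, continuous (derive_in (slab T) (derive_in (slab T) u d) d')}.
Proof.
by case: solu => -[_ ureg] _ _ _ /ureg[_ [_ ureg2]] /ureg2[ud [udc _]].
Qed.

Let dirt : spacetime_dir (dir_t : ST). Proof. by left. Qed.
Let dirx (i : 'I_n) : spacetime_dir (dir_x i : ST). Proof. by right; exists i. Qed.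

Let u_outside t x : 1 <= t -> (t%:E < T)%E -> r + A_k k t < enorm x -> u (t, x) = 0.
Proof.
move=> t1 tT xr; apply/eqP; apply/negP => /negP ux.
have /(cone t1 tT) : supp (fun x => u (t, x)) x by exact: subset_closure.
by rewrite /eball/= ltNge (ltW xr).
Qed.

Lemma cone_space_compact : (1 <= n)%N -> space_compact T u.
Proof.
move=> n0 t1 t11 t1T; exists (r + A_k k t1) => t x /andP[t1' tt1] xr.
apply: u_outside => //; first exact: ltT t1T.
apply: le_lt_trans (lt_le_trans xr (norm_le_enorm x)).
by rewrite lerD2l le_A_k ?t1'.
Qed.

Let n0 : (1 <= n)%N. Proof. by case: (n) i0 => [[]|]. Qed.
Let su : space_compact T u := cone_space_compact n0.
Let sv : space_compact T v := space_compact_Dt su.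

(** A point strictly outside the closed ball at time t is still outside at nearby
    times, so u vanishes near t along the time line through it. *)
Lemma velocity_outside t x : 1 < t -> (t%:E < T)%E ->
  ~~ (enorm x <= r + A_k k t) -> v (t, x) = 0.
Proof.
move=> t1 tT; rewrite -ltNge => xr.
have dv := Dt_is_derive t1 tT ((reg1 dirt).1 (t, x) (conj (ltW t1) tT)).
have [t' tt' t'T] := lifespan_gap tT.
have cA := is_derive_continuous (is_derive_A_k (proj2 (andP k01)) (lt_trans ltr01 t1)).
have u_eq0 : \forall s \near t, 0 = u (s, x).
  near=> s; rewrite u_outside//.
  - by apply: ltW; near: s; exact: lt_nbhsr.
  - by apply: ltT t'T; apply: ltW; near: s; exact: lt_nbhsl.
  - rewrite -ltrBrDl; near: s; apply: (cvgr_lt _ cA).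
    by rewrite ltrBrDl.
have := near_eq_is_derive u_eq0 (is_derive_const 0 t).
by case: dv => _ + [_ h]; rewrite h.
Unshelve. all: by end_near. Qed.

Let U t := wmean i0 (slice u t).
Let U1 t := wmean i0 (slice v t).
Let F t := wmean i0 (fun x => `|v (t, x)| `^ p).

Let bs g t : {within slab T, continuous g} -> space_compact T g ->
  1 <= t -> (t%:E < T)%E -> bounded_support (fun x => g (t, x)).
Proof. by move=> cg sg t1 tT; rewrite -sliceE//; exact: (slice_bounded_support T1 cg sg tT). Qed.

Let sc g t : {within slab T, continuous g} ->
  1 <= t -> (t%:E < T)%E -> continuous (fun x => g (t, x)).
Proof. by move=> cg t1 tT; rewrite -sliceE//; exact: (slice_continuous T1 cg tT). Qed.

(** Two integrations by parts move the Laplacian to the weight, which is an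
    eigenfunction of the Laplacian with eigenvalue 1. *)
Lemma wmean_Laplacian t : 1 <= t -> (t%:E < T)%E ->
  bounded_support (fun x => Laplacian T u (t, x)) /\
  wmean i0 (fun x => Laplacian T u (t, x)) = wmean i0 (fun x => u (t, x)).
Proof.
move=> t1 tT.
have sxu i : space_compact T (Dx T i u) by exact: space_compact_Dx.
have sxxu i : space_compact T (Dx T i (Dx T i u)) by exact: space_compact_Dx.
have bxx i : bounded_support (fun x => Dx T i (Dx T i u) (t, x)).
  by apply: bs => //; exact: (reg2 (dirx i) (dirx i)).2.
have [bL ->] := bounded_support_sum i0 (index_enum 'I_n) bxx; split=> //.
have xx i : wmean i0 (fun x => Dx T i (Dx T i u) (t, x))
    = (i == i0)%:R * wmean i0 (fun x => u (t, x)).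
  have cx := (reg1 (dirx i)).2; have cxx := (reg2 (dirx i) (dirx i)).2.
  have -> : wmean i0 (fun x => Dx T i (Dx T i u) (t, x))
      = - (i == i0)%:R * wmean i0 (fun x => Dx T i u (t, x)).
    apply: wmean_by_parts; try exact: sc.
    - exact: bs.
    - exact: bs.
    - by move=> x; apply: Dx_is_derive => //; apply: (reg2 (dirx i) (dirx i)).1.
  have -> : wmean i0 (fun x => Dx T i u (t, x))
      = - (i == i0)%:R * wmean i0 (fun x => u (t, x)).
    apply: wmean_by_parts; try exact: sc.
    - exact: bs.
    - exact: bs.
    - by move=> x; apply: Dx_is_derive => //; apply: (reg1 (dirx i)).1.
  by rewrite mulrA mulrNN; case: (i == i0); rewrite ?mulr1 ?mulr0.
rewrite (eq_bigr _ (fun i _ => xx i)) (bigD1 i0)//= eqxx mul1r.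
by rewrite big1 ?addr0// => i /negbTE ->; rewrite mul0r.
Qed.

Let bs_source t : 1 <= t -> (t%:E < T)%E -> bounded_support (fun x => `|v (t, x)| `^ p).
Proof.
move=> t1 tT; have p0 : 0 < p := lt_trans ltr01 p1.
have bv : bounded_support (fun x => v (t, x)) := bs (reg1 dirt).2 sv t1 tT.
have [M [rho [M0 rho0 vM v0]]] := bounded_supportP bv.
exists (M `^ p), rho => x; split; last first.
  by move=> /v0 ->; rewrite normr0 powR0// lt0r_neq0.
rewrite ger0_norm ?powR_ge0//; apply: ge0_ler_powR; rewrite ?nnegrE ?(ltW p0)//.
Qed.

Let derU t : 1 < t -> (t%:E < T)%E -> is_derive t 1 U (U1 t).
Proof.
move=> t1 tT; apply: wmean_slice_derive => //; first exact: (reg1 dirt).2.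
exact: (reg1 dirt).1.
Qed.

Let derU1 t : 1 < t -> (t%:E < T)%E ->
  is_derive t 1 U1 (F t + t `^ (- (2 * k)) * U t - 2 * t^-1 * U1 t).
Proof.
move=> t1 tT; have t1' := ltW t1.
have [bL wL] := wmean_Laplacian t1' tT.
have bv := bs (reg1 dirt).2 sv t1' tT.
have bF := bs_source t1' tT.
suff <- : wmean i0 (slice (Dt T v) t) = F t + t `^ (- (2 * k)) * U t - 2 * t^-1 * U1 t.
  apply: wmean_slice_derive => //; first exact: (reg1 dirt).2.
    exact: (reg2 dirt dirt).2.
  exact: (reg2 dirt dirt).1.
rewrite /F /U /U1 !sliceE// -wL.
have -> : (fun x => Dt T v (t, x)) = (fun x => (- (2 * t^-1)) * v (t, x)
    + (t `^ (- (2 * k)) * Laplacian T u (t, x) + `|v (t, x)| `^ p)).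
  apply/funext => x; case: solu => _ pde _ _; rewrite -(pde t x t1 tT) -/v; ring.
by rewrite wmeanD ?wmeanD//; [ring|exact: bounded_supportD].
Qed.

Let F_ge0 t : 1 < t -> (t%:E < T)%E -> 0 <= F t.
Proof.
move=> t1 tT; rewrite -(@wmean0 R n i0); apply: le_wmean.
- exact: bounded_support0.
- exact: bs_source (ltW t1) tT.
- by move=> x; exact: powR_ge0.
Qed.

Let contU t : 1 <= t -> (t%:E < T)%E -> {for t, continuous U}.
Proof.
by move=> _ tT; exact: (@wmean_slice_continuous _ _ _ T1 i0 u t cu su tT).
Qed.

Let contU1 t : 1 <= t -> (t%:E < T)%E -> {for t, continuous U1}.
Proof.
by move=> _ tT; exact: (@wmean_slice_continuous _ _ _ T1 i0 v t (reg1 dirt).2 sv tT).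
Qed.

Variables (K beta z : R).
Hypothesis K0 : 0 < K.
Hypothesis ball_mass : forall t, 1 <= t ->
  wmean i0 (fun x => (enorm x <= r + A_k k t)%R%:R) <= K * (expR (A_k k t) * t `^ beta).
Hypothesis z0 : 0 < z.
Hypothesis data0 : 0 <= eps * wmean i0 u0.
Hypothesis data1 : 0 <= eps * wmean i0 u1.
Hypothesis data : z = eps * wmean i0 u0 + eps * wmean i0 u1.
Hypothesis bu0 : bounded_support u0.
Hypothesis bu1 : bounded_support u1.

Let U_at1 : U 1 = eps * wmean i0 u0.
Proof.
rewrite /U sliceE// -wmeanZ//; congr wmean; apply/funext => x.
by case: solu.
Qed.

Let U1_at1 : U1 1 = eps * wmean i0 u1.
Proof.
rewrite /U1 sliceE// -wmeanZ//; congr wmean; apply/funext => x.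
by case: solu.
Qed.

Let kap : R := (1 - 2 `^ (k - 1)) / 2.
Let kap0 : 0 < kap.
Proof.
by rewrite divr_gt0// subr_gt0 powR2_lt1//; case/andP: k01.
Qed.

(** The averages U and U1 of u and its time derivative satisfy the differential
    equation studied above with source F, the average of |u_t|^p. Jensen bounds F
    from below by U1 and the mass of the light cone, and the profile bounds U1
    from below, so the profile satisfies a Riccati inequality. *)
Lemma solution_riccati (Phi : R -> R) :
  (forall t, 0 < t -> is_derive t 1 Phi (t `^ (- ((p - 1) * (1 + k / 2 + beta))))) ->
  forall t, 2 <= t -> (t%:E < T)%E ->
  kap * (kap / K) `^ (p - 1) * (p - 1) * (Phi t - Phi 2) <= z `^ (1 - p).
Proof.
move=> dPhi.
have h0 : 0 <= U 1 by rewrite U_at1.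
have h1 : 0 <= U1 1 by rewrite U1_at1.
have h01 : 0 < U 1 + U1 1 by rewrite U_at1 U1_at1 -data.
have Zz t : 1 <= t -> (t%:E < T)%E -> z <= profile k U U1 t.
  move=> t1 tT; rewrite data -U_at1 -U1_at1.
  exact: (profile_ge k01 contU contU1 derU derU1 F_ge0 h0 h1 h01).
have ge1 (t : R) : 2 <= t -> 1 <= t by move=> t2; apply: le_trans t2; rewrite ler1n.
have gt1 (t : R) : 2 < t -> 1 < t by move=> t2; apply: lt_trans t2; rewrite ltr1n.
apply: (@riccati_time _ T (profile k U U1) (dprofile k U U1 F)) => //.
- by apply: mulr_gt0 => //; apply: powR_gt0; exact: divr_gt0.
- move=> t /ge1 t1 tT; exact: (profile_continuous k01 contU contU1 t1 tT).
- move=> t /gt1 t1 tT; exact: (is_derive_profile k01 derU derU1 t1 tT).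
- move=> t t2 tT; have t1 := gt1 t t2; have t0 := lt_trans ltr01 t1.
  apply: le_trans (dprofile_ge k01 contU contU1 derU derU1 F_ge0 h0 h1 h01 t1 tT).
  have Z0 : 0 < profile k U U1 t by exact: lt_le_trans z0 (Zz t (ltW t1) tT).
  have U1ge := le_profile_velocity k01 contU contU1 derU derU1 F_ge0 h0 h1 h01 (ltW t2) tT.
  apply: (@source_ge_profile _ k p K kap beta (A_k k t) t _ (U1 t)) => //.
  have U1E : U1 t = wmean i0 (fun x => v (t, x)) by rewrite /U1 sliceE// ltW.
  have U0 : 0 < wmean i0 (fun x => v (t, x)).
    rewrite -U1E; apply: lt_le_trans U1ge.
    exact: (mulr_gt0 kap0 (mulr_gt0 (mulr_gt0 (powR_gt0 _ t0) (expR_gt0 _)) Z0)).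
  have B0 : 0 < K * (expR (A_k k t) * t `^ beta).
    exact: (mulr_gt0 K0 (mulr_gt0 (expR_gt0 _) (powR_gt0 _ t0))).
  rewrite U1E; exact: (wmean_jensen (P := fun x => enorm x <= r + A_k k t) p1
    (bs (reg1 dirt).2 sv (ltW t1) tT) (bs_source (ltW t1) tT)
    (@bounded_support_ball R n (r + A_k k t))
    (fun x => velocity_outside (x := x) t1 tT) B0 (ball_mass (ltW t1)) U0).
- by move=> t /ge1 t1 tT; exact: Zz.
Qed.

End Solution.

(** * Initial data and the mass of the light cone *)
Section Data.
Context {R : realType} {n : nat}.
Variable i0 : 'I_n.
Local Notation V := 'rV[R]_n.
Implicit Types (f : V -> R).

Lemma C0j_continuous j f : C0j j f -> continuous f.
Proof.
move=> [cf _]; have : {within setT, continuous f} by case: j cf => [|j] [].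
by move=> ?; apply/continuous_subspace_setT.
Qed.

Lemma supp_bounded_support f (r : R) : continuous f -> supp f `<=` eball r ->
  bounded_support f.
Proof.
move=> cf sf; apply: (@continuous_bounded_support _ _ f r) => // x xr.
apply/eqP; apply/negP => /negP fx.
have /sf : supp f x by exact: subset_closure.
by rewrite /eball/= ltNge (ltW (lt_le_trans xr (norm_le_enorm x))).
Qed.

Lemma wmean_ge0 f : bounded_support f -> (forall x, 0 <= f x) -> 0 <= wmean i0 f.
Proof.
move=> bf f0; rewrite -(@wmean0 R n i0); apply: le_wmean => //.
exact: bounded_support0.
Qed.

(** The radius r + A(t) is at most a constant times t^(1-k). *)
Lemma wmean_cone_le (k r : R) : 0 < k < 1 -> 0 < r -> exists2 K : R, 0 < K &
  forall t, 1 <= t -> wmean i0 (fun x => (enorm x <= r + A_k k t)%R%:R)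
     <= K * (expR (A_k k t) * t `^ ((1 - k) * (n%:R - 1) / 2)).
Proof.
move=> k01 r0; have [K K0 hK] := wmean_ball_le i0 r0.
have k1 : 0 < 1 - k by rewrite subr_gt0; case/andP: k01.
have n1 : 0 <= (n%:R - 1) / 2 :> R.
  by rewrite divr_ge0// subr_ge0 ler1n; case: (n) i0 => [[]|].
pose c := r + (1 - k)^-1.
have c0 : 0 < c by rewrite addr_gt0// invr_gt0.
exists (K * expR r * c `^ ((n%:R - 1) / 2)) => [|t t1].
  by rewrite !mulr_gt0 ?expR_gt0 ?powR_gt0.
have t0 : 0 < t := lt_le_trans ltr01 t1.
have A0 : 0 <= A_k k t by rewrite -(@A_k1 R k) le_A_k ?lexx.
have rho_le : r + A_k k t <= c * t `^ (1 - k).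
  have tk : 1 <= t `^ (1 - k).
    by rewrite -[leLHS](powRr0 t) ler_powR// ltW.
  rewrite mulrDl; apply: lerD; first by rewrite ler_peMr// ltW.
  by rewrite /A_k /phi_k mulrC gerBl divr_ge0 ?powR_ge0// ltW.
apply: le_trans (hK _ _) _; first by rewrite lerDl.
rewrite expRD -!mulrA ler_wpM2l ?(ltW K0)// ler_wpM2l ?expR_ge0//.
rewrite [leRHS]mulrCA ler_wpM2l ?expR_ge0//.
apply: (@le_trans _ _ ((c * t `^ (1 - k)) `^ ((n%:R - 1) / 2))).
  apply: ge0_ler_powR => //; rewrite nnegrE.
    by rewrite addr_ge0// ltW.
  by rewrite mulr_ge0 ?powR_ge0// ltW.
by rewrite powRM ?powR_ge0 ?(ltW c0)// -powRrM mulrA.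
Qed.

End Data.
Theorem theorem1p1 (R : realType) (n : nat) (k p r : R)
    (u0 u1 : 'rV[R]_n -> R) :
  (1 <= n)%N -> 0 < k < 1 -> 0 < r ->
  C0j 2 u0 -> C0j 1 u1 ->
  (forall x, 0 <= u0 x) -> (forall x, 0 <= u1 x) ->
  (exists x, u0 x <> 0 \/ u1 x <> 0) ->
  supp u0 `<=` eball r -> supp u1 `<=` eball r ->
  1 < p -> (p%:E <= pGla ((1 - k) * n%:R + 2 * k + 2))%E ->
  exists eps0 C : R, [/\ 0 < eps0, 0 < C &
    forall (eps : R) (T : \bar R) (u : R * 'rV[R]_n -> R),
      0 < eps <= eps0 -> (1 < T)%E ->
      solution k p eps u0 u1 T u ->
      supp_cone k r T u ->
      is_lifespan k p eps u0 u1 u T ->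
      [/\ (T < +oo)%E,
          (p%:E < pGla ((1 - k) * n%:R + 2 * k + 2))%E ->
          (T <= (C * eps `^ (- ((p - 1)^-1
                   - ((1 - k) * n%:R + 2 * k + 1) / 2)^-1))%:E)%E &
          (p%:E = pGla ((1 - k) * n%:R + 2 * k + 2))%E ->
          (T <= (expR (C * eps `^ (- (p - 1))))%:E)%E]].
Proof.
move=> n1 k01 r0 C0u0 C0u1 u0_ge0 u1_ge0 u01 su0 su1 p1 pG.
pose i0 := Ordinal n1; have /andP[k0 k1] := k01.
have p10 : 0 < p - 1 by rewrite subr_gt0.
have cu0 := C0j_continuous C0u0; have cu1 := C0j_continuous C0u1.
have bu0 := supp_bounded_support cu0 su0; have bu1 := supp_bounded_support cu1 su1.
have I0 := wmean_ge0 i0 bu0 u0_ge0; have I1 := wmean_ge0 i0 bu1 u1_ge0.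
pose z := wmean i0 u0 + wmean i0 u1.
have z0 : 0 < z.
  have [x [/eqP ux|/eqP ux]] := u01.
    by rewrite ltr_pwDl// (wmean_gt0 i0 bu0 cu0 u0_ge0 (x0 := x))// lt_neqAle eq_sym ux u0_ge0.
  by rewrite ltr_wpDl// (wmean_gt0 i0 bu1 cu1 u1_ge0 (x0 := x))// lt_neqAle eq_sym ux u1_ge0.
have [K K0 cone_mass] := wmean_cone_le i0 k01 r0.
(* gam collects the powers of t that the velocity and the mass of the light cone
   lose against the exponential; p is the Glassey exponent exactly when
   (p - 1) * gam = 1, in which case t^(-(p - 1) gam) has a logarithmic primitive. *)
pose gam := ((1 - k) * n%:R + 2 * k + 1) / 2.
pose kap := (1 - 2 `^ (k - 1)) / 2 : R.
pose c := kap * (kap / K) `^ (p - 1).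
have kap0 : 0 < kap by rewrite divr_gt0// subr_gt0 powR2_lt1.
have c0 : 0 < c by apply: mulr_gt0 => //; apply: powR_gt0; exact: divr_gt0.
have riccati eps T u : 0 < eps -> (1 < T)%E -> solution k p eps u0 u1 T u ->
    supp_cone k r T u -> forall Phi : R -> R,
    (forall t : R, 0 < t -> is_derive t 1 Phi (t `^ (- ((p - 1) * gam)))) ->
    forall t, 2 <= t -> (t%:E < T)%E ->
    c * (p - 1) * (Phi t - Phi 2) <= (z * eps) `^ (1 - p).
  move=> e0 T1 sol cone Phi dPhi.
  have e1 : gam = 1 + k / 2 + (1 - k) * (n%:R - 1) / 2 by rewrite /gam; field.
  apply: (solution_riccati (i0 := i0) k01 p1 T1 sol cone K0 cone_mass) => //.
  - by rewrite mulr_gt0.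
  - by rewrite mulr_ge0// ltW.
  - by rewrite mulr_ge0// ltW.
  - by rewrite /z; ring.
  - by rewrite -e1.
pose m := (1 - k) * n%:R + 2 * k + 2.
have m1 : 0 < m - 1.
  rewrite /m; have : 0 <= (1 - k) * n%:R by rewrite mulr_ge0// subr_ge0 ltW.
  by move: ((1 - k) * _) => y; lra.
have gamE : gam = (m - 1) / 2 by rewrite /gam /m; field.
have pGE : pGla m = ((m + 1) / (m - 1))%:E by rewrite /pGla -subr_gt0 m1.
have critE : (p%:E == pGla m) = ((p - 1) * gam == 1).
  rewrite pGE gamE eqe; apply/eqP/eqP => [->|h]; first by field; rewrite lt0r_neq0.
  apply: (mulIf (lt0r_neq0 m1)); rewrite divfK ?lt0r_neq0//; move: h; lra.
have critL : (p%:E <= pGla m)%E = ((p - 1) * gam <= 1).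
  rewrite pGE gamE lee_fin ler_pdivlMr//; apply/idP/idP; lra.
move: pG; rewrite -/m critL le_eqVlt => /predU1P[th1|th1].
- have [C C0 hC] := exponential_time p1 c0 z0.
  have pm : p%:E = pGla m by apply/eqP; rewrite critE th1.
  exists 1, C; split=> // eps T u /andP[e0 e1] T1 sol cone _.
  have TC : (T <= (expR (C * eps `^ (- (p - 1))))%:E)%E.
    apply: ereal_le_real => // t t1 tT; apply: hC; rewrite ?e0 ?e1 ?(lt_trans ltr01 t1)//.
    move=> t2; apply: (riccati eps T u e0 T1 sol cone) => // s s0.
    by rewrite th1 powR_inv1 ?(ltW s0)//; exact: is_derive1_ln.
  split=> //; first exact: le_lt_trans TC (ltry _).
  by rewrite -pm ltxx.
- have [C C0 hC] := power_time p1 th1 c0 z0.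
  exists 1, C; split=> // eps T u /andP[e0 e1] T1 sol cone _.
  have TC : (T <= (C * eps `^ (- ((p - 1)^-1 - gam)^-1))%:E)%E.
    apply: ereal_le_real => // t t1 tT; apply: hC; rewrite ?e0 ?e1 ?(lt_trans ltr01 t1)//.
    move=> t2; apply: (riccati eps T u e0 T1 sol cone) => // s s0.
    exact: is_derive_phi_k.
  split=> //; first exact: le_lt_trans TC (ltry _).
  by move=> /eqP; rewrite critE (lt_eqF th1).
Qed.
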